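(* For each $V\in\mathring{\mathbb V}$ there exists a unique $\boldsymbol H[V]\in\mathbb V^{d\times d}$ such that $$\langle \boldsymbol H[V],\Phi\rangle=\langle \mathrm D^2V\,|\,\Phi\rangle\quad\text{for all }\Phi\in\mathbb V .$$
   Context: Let $\Omega\subset\mathbb R^d$ be an open bounded Lipschitz domain with outward pointing unit normal $\boldsymbol n:\partial\Omega\to\mathbb R^d$. Let $\mathscr T$ be a conforming triangulation of $\Omega$: a finite family of open simplices (segments for $d=1$, triangles for $d=2$, tetrahedra for $d=3$) such that for any $K,J\in\mathscr T$ the set $\overline K\cap\overline J$ is a full subsimplex (either $\emptyset$, a vertex, an edge, a face, or the whole of $\overline K$ and $\overline J$) of both $\overline K$ and $\overline J$, and $\bigcup_{K\in\mathscr T}\overline K=\overline\Omega$. Fix an integer $p\ge 1$ and let $\mathbb P^p$ be the space of polynomials in $d$ variables of degree at most $p$. The finite element spaces are $$\mathbb V:=\{\Phi\in H^1(\Omega):\ \Phi|_K\in\mathbb P^p\ \text{for all }K\in\mathscr T\},\qquad \mathring{\mathbb V}:=\mathbb V\cap H^1_0(\Omega).$$ $\mathbb V^{d\times d}$ denotes the $d\times d$ matrices with entries in $\mathbb V$. For a matrix-valued function $\boldsymbol G$ and a scalar function $\Phi$, $\langle\boldsymbol G,\Phi\rangle:=\int_\Omega \boldsymbol G\,\Phi\in\mathbb R^{d\times d}$ (entrywise). For vectors, $\boldsymbol x\otimes\boldsymbol y:=\boldsymbol x\boldsymbol y^{\mathsf T}$. Gradients are column vectors. The generalized Hessian $\mathrm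 D^2V$ of $V\in\mathring{\mathbb V}$ acts on a test function $\Phi$ by $$\langle \mathrm D^2V\,|\,\Phi\rangle:=-\int_\Omega\nabla V\otimes\nabla\Phi+\int_{\partial\Omega}\nabla V\otimes\boldsymbol n\,\Phi\ \in\mathbb R^{d\times d},$$ for $\Phi\in C^\infty(\Omega)$ (smooth up to the boundary) and, by the same formula, for $\Phi\in\mathbb V$. Here on $\partial\Omega$ the gradient $\nabla V$ is the trace of the (piecewise polynomial) gradient from the adjacent elements. *)

(* Defs.v *)
From HB Require Import structures.
From mathcomp Require Import all_boot all_order all_algebra.
From mathcomp Require Import all_classical all_reals all_analysis.
From mathcomp Require mpoly.

Set Implicit Arguments.
Unset Strict Implicit.
Unset Printing Implicit Defensive.
Import Order.TTheory GRing.Theory Num.Theory.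
Import numFieldNormedType.Exports.
Local Open Scope classical_set_scope.
Local Open Scope ring_scope.

(* Points of R^d are row vectors ['rV[R]_d]; vector fields (gradients, the
   normal) take values in column vectors ['cV[R]_d].  Theorems about R^d with
   d >= 1 are stated in R^(d.+1). *)

Definition rV_display : measure_display -> measure_display.
Proof. exact. Qed.

Section rV_measurable.
Context (R : realType) (n : nat).

Definition rV_coord (i : 'I_n) (x : 'rV[R]_n) : measurableTypeR R := x ord0 i.

Let rV_set0 : g_sigma_preimage rV_coord set0.
Proof. exact: sigma_algebra0. Qed.

Let rV_setC A : g_sigma_preimage rV_coord A -> g_sigma_preimage rV_coord (~` A).
Proof. exact: sigma_algebraC. Qed.

Let rV_bigcup (F : (set 'rV[R]_n)^nat) :
  (forall i, g_sigma_preimage rV_coord (F i)) ->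
  g_sigma_preimage rV_coord (\bigcup_i (F i)).
Proof. exact: sigma_algebra_bigcup. Qed.

(* The Borel sigma-algebra of R^n, as the one generated by the coordinates. *)
HB.instance Definition _ :=
  @isMeasurable.Build (rV_display default_measure_display)
    'rV[R]_n (g_sigma_preimage rV_coord) rV_set0 rV_setC rV_bigcup.

End rV_measurable.

Section rV_measurable_theory.
Context (R : realType).

Lemma measurable_rV_coord n (i : 'I_n) :
  measurable_fun [set: 'rV[R]_n] (@rV_coord R n i).
Proof.
move=> _ Y mY; rewrite setTI; apply: sub_sigma_algebra => /=.
rewrite -bigcup_seq/=; exists i => /=; first by rewrite mem_index_enum.
by exists Y => //; rewrite setTI.
Qed.

Lemma measurable_fun_rVP d (T : measurableType d) n (f : T -> 'rV[R]_n) :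
  (forall i, measurable_fun [set: T] (@rV_coord R n i \o f)) ->
  measurable_fun [set: T] f.
Proof.
move=> mf; apply: (@measurability _ _ _ _ setT f
  (\big[setU/set0]_(i < n)
     preimage_set_system setT (@rV_coord R n i) measurable)) => //.
move=> _ [A + <-].
rewrite -bigcup_seq => -[i _ [B mB <-]].
by rewrite !setTI -comp_preimage -[X in measurable X]setTI; exact: mf.
Qed.

Definition rV_cons n (p : measurableTypeR R * 'rV[R]_n) : 'rV[R]_n.+1 :=
  \row_(i < n.+1) if unlift ord0 i is Some j then p.2 ord0 j else p.1.

Definition rV_uncons n (x : 'rV[R]_n.+1) : measurableTypeR R * 'rV[R]_n :=
  (x ord0 ord0, \row_(j < n) x ord0 (lift ord0 j)).

Lemma rV_consK n : cancel (@rV_cons n) (@rV_uncons n).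
Proof.
move=> [a x]; rewrite /rV_uncons !mxE unlift_none; congr pair.
by apply/rowP => j; rewrite !mxE liftK.
Qed.

Lemma measurable_rV_cons n : measurable_fun setT (@rV_cons n).
Proof.
apply: measurable_fun_rVP => i.
rewrite /comp /rV_coord /rV_cons.
case: (unliftP ord0 i) => [j|] ->.
  rewrite (_ : (fun=> _) = @rV_coord R n j \o snd).
    by apply: measurableT_comp => //; exact: measurable_rV_coord.
  by apply/funext => p; rewrite /= mxE liftK.
rewrite (_ : (fun=> _) = fst)//.
by apply/funext => p; rewrite /= mxE unlift_none.
Qed.

Lemma measurable_rV_uncons n : measurable_fun setT (@rV_uncons n).
Proof.
apply: measurable_fun_pair; first exact: measurable_rV_coord.
apply: measurable_fun_rVP => i.
rewrite (_ : _ \o _ = @rV_coord R n.+1 (lift ord0 i)).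
  exact: measurable_rV_coord.
by apply/funext => x; rewrite /= /rV_coord mxE.
Qed.

End rV_measurable_theory.

Section lebesgue_measure_step.
Local Open Scope ereal_scope.
Context (R : realType) (n : nat).
Variable mu : {sigma_finite_measure set 'rV[R]_n -> \bar R}.

Definition leb_step : set 'rV[R]_n.+1 -> \bar R :=
  pushforward (@lebesgue_measure R \x mu) (@rV_cons R n).

Let leb_step0 : leb_step set0 = 0.
Proof. by rewrite /leb_step /pushforward preimage_set0 measure0. Qed.

Let leb_step_ge0 A : 0 <= leb_step A.
Proof. by rewrite /leb_step /pushforward measure_ge0. Qed.

Let leb_step_sigma_additive : semi_sigma_additive leb_step.
Proof.
move=> F mF tF mUF; rewrite /leb_step /pushforward preimage_bigcup.
have mc := @measurable_rV_cons R n.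
apply: measure_semi_sigma_additive.
- by move=> k; rewrite -[X in measurable X]setTI; exact: mc.
- apply/trivIsetP => /= i j _ _ ij; rewrite -preimage_setI.
  by move/trivIsetP : tF => /(_ _ _ _ _ ij) ->//; rewrite preimage_set0.
- by rewrite -preimage_bigcup -[X in measurable X]setTI; exact: mc.
Qed.

HB.instance Definition _ := isMeasure.Build _ _ _
  leb_step leb_step0 leb_step_ge0 leb_step_sigma_additive.

Let leb_step_sigma_finite : sigma_finite setT leb_step.
Proof.
have /sigma_finiteP[F [FT ndF Foo]] := sigma_finiteT (@lebesgue_measure R).
have /sigma_finiteP[G [GT ndG Goo]] := sigma_finiteT mu.
exists (fun k => @rV_uncons R n @^-1` (F k `*` G k)).
  rewrite -preimage_bigcup (_ : \bigcup_k _ = setT) ?preimage_setT//.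
  apply/seteqP; split=> // -[x y] _.
  have [k _ Fkx] : (\bigcup_k F k) x by rewrite -FT.
  have [l _ Gly] : (\bigcup_k G k) y by rewrite -GT.
  exists (maxn k l) => //; split => /=.
    by move: x Fkx; exact/subsetPset/ndF/leq_maxl.
  by move: y Gly; exact/subsetPset/ndG/leq_maxr.
move=> k; have [mF Fk] := Foo k; have [mG Gk] := Goo k; split.
  by rewrite -[X in measurable X]setTI; apply: measurable_rV_uncons => //;
    exact: measurableX.
rewrite /leb_step /pushforward -comp_preimage (_ : _ \o _ = id); last first.
  by apply/funext => p; rewrite /= rV_consK.
by rewrite preimage_id product_measure1E// lte_mul_pinfty// ge0_fin_numE.
Qed.

HB.instance Definition _ := Measure_isSigmaFinite.Build _ _ _
  leb_step leb_step_sigma_finite.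

End lebesgue_measure_step.

(* Lebesgue measure on R^n; on the one-point space R^0 it is the unit mass. *)
Fixpoint leb (R : realType) (n : nat) :
    {sigma_finite_measure set 'rV[R]_n -> \bar R} :=
  match n with
  | 0 => \d_(0 : 'rV[R]_0)
  | n'.+1 => leb_step (leb R n')
  end.

Definition bd (T : topologicalType) (A : set T) : set T :=
  closure A `\` interior A.

Section vector_calculus.
Context (R : realType) (d : nat).
Implicit Types (f g : 'rV[R]_d -> R) (x : 'rV[R]_d).

Definition partial (i : 'I_d) f : 'rV[R]_d -> R :=
  'D_(delta_mx ord0 i : 'rV[R]_d) f.

Definition grad f (x : 'rV[R]_d) : 'cV[R]_d := \col_i partial i f x.

Definition outer_prod (u v : 'cV[R]_d) : 'M[R]_d := u *m v^T.

Definition mx_integral (D : set 'rV[R]_d) (G : 'rV[R]_d -> 'M[R]_d) : 'M[R]_d :=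
  \matrix_(i, j) \int[leb R d]_(x in D) G x i j.

(* Euclidean length; the norm [`|_|] of the library on matrices is the max
   norm (the two induce the same topology and the same bounded sets). *)
Definition enorm m (x : 'rV[R]_m) : R := Num.sqrt (\sum_i x ord0 i ^+ 2).

End vector_calculus.

Section lipschitz_domains.
Context (R : realType) (d : nat).

(* Near each boundary point, in coordinates [y *m Q] given by an orthogonal
   matrix Q, the set Omega is the strict epigraph of a Lipschitz function of the
   last d coordinates. *)
Definition lipschitz_boundary (Omega : set 'rV[R]_d.+1) : Prop :=
  forall x, bd Omega x ->
    exists (r : R) (Q : 'M[R]_d.+1) (gamma : 'rV[R]_d -> R) (L : R),
      [/\ 0 < r,
          Q *m Q^T = 1%:M,
          forall s t, `|gamma s - gamma t| <= L * enorm (s - t) &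
          forall y, ball x r y ->
            (Omega y <-> gamma (col' ord0 (y *m Q)) < (y *m Q) ord0 ord0)].

Definition lipschitz_domain (Omega : set 'rV[R]_d.+1) : Prop :=
  [/\ open Omega, connected Omega, bounded_set Omega &
      lipschitz_boundary Omega].

(* nu is the outward unit normal of Omega at x: the directions making an obtuse
   angle with nu enter Omega, those making an acute angle leave it.  At most one
   vector has this property; it exists wherever the boundary is differentiable. *)
Definition outward_normal_at (Omega : set 'rV[R]_d.+1) (x : 'rV[R]_d.+1)
    (nu : 'cV[R]_d.+1) : Prop :=
  [/\ (nu^T *m nu) ord0 ord0 = 1,
      forall h : 'rV[R]_d.+1, (h *m nu) ord0 ord0 < 0 ->
        \forall t \near 0^'+, Omega (x + t *: h) &
      forall h : 'rV[R]_d.+1, 0 < (h *m nu) ord0 ord0 ->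
        \forall t \near 0^'+, ~ Omega (x + t *: h)].

End lipschitz_domains.

Section simplices.
Context (R : realType).

(* An m-dimensional simplex of R^d is given by the matrix of its m + 1 vertices,
   one per row. *)

Definition edges m d (a : 'M[R]_(m.+1, d)) : 'M[R]_(m, d) :=
  \matrix_(i < m) (row (lift ord0 i) a - row ord0 a).

Definition affinely_free m d (a : 'M[R]_(m.+1, d)) : bool := row_free (edges a).

Definition open_simplex m d (a : 'M[R]_(m.+1, d)) : set 'rV[R]_d :=
  [set x | exists c : 'rV[R]_m.+1,
    [/\ forall i, 0 < c ord0 i, \sum_i c ord0 i = 1 & x = c *m a]].

(* The closed subsimplex spanned by the vertices with index in S; it is empty
   when S is. *)
Definition subsimplex m d (a : 'M[R]_(m.+1, d)) (S : {set 'I_m.+1}) :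
    set 'rV[R]_d :=
  [set x | exists c : 'rV[R]_m.+1,
    [/\ forall i, 0 <= c ord0 i, forall i, i \notin S -> c ord0 i = 0,
        \sum_i c ord0 i = 1 & x = c *m a]].

Definition ref_simplex m : set 'rV[R]_m :=
  [set t | (forall i, 0 < t ord0 i) /\ \sum_i t ord0 i < 1].

Definition simplex_param m d (a : 'M[R]_(m.+1, d)) (t : 'rV[R]_m) : 'rV[R]_d :=
  row ord0 a + t *m edges a.

(* The integral of f over the simplex a with respect to the m-dimensional surface
   measure: the affine parametrization has Jacobian sqrt (det (E E^T)), where E is
   the matrix of its edges.  For m = 0 this is the value of f at the vertex. *)
Definition simplex_integral m d (a : 'M[R]_(m.+1, d)) (f : 'rV[R]_d -> R) : R :=
  Num.sqrt (\det (edges a *m (edges a)^T)) *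
  \int[leb R m]_(t in @ref_simplex m) f (simplex_param a t).

End simplices.

Section triangulations.
Context (R : realType) (d : nat) (Omega : set 'rV[R]_d.+1).
Context (I : finType) (T : I -> 'M[R]_(d.+2, d.+1)).

Definition conforming_triangulation : Prop :=
  [/\ forall K, affinely_free (T K),
      injective (fun K => open_simplex (T K)),
      forall K J, exists S S' : {set 'I_d.+2},
        closure (open_simplex (T K)) `&` closure (open_simplex (T J)) =
          subsimplex (T K) S /\
        closure (open_simplex (T K)) `&` closure (open_simplex (T J)) =
          subsimplex (T J) S' &
      \bigcup_K closure (open_simplex (T K)) = closure Omega].

(* The face of K opposite to its m-th vertex, by its vertices. *)
Definition face (K : I) (m : 'I_d.+2) : 'M[R]_(d.+1, d.+1) := row' m (T K).

Definition boundary_face (K : I) (m : 'I_d.+2) : bool :=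
  `[< subsimplex (face K m) [set: _]%SET `<=` bd Omega >].

(* n is the outward unit normal of Omega at almost every point of the boundary. *)
Definition outward_unit_normal (n : 'rV[R]_d.+1 -> 'cV[R]_d.+1) : Prop :=
  forall K m, boundary_face K m ->
    {ae leb R d, forall t, @ref_simplex R d t ->
      outward_normal_at Omega (simplex_param (face K m) t)
        (n (simplex_param (face K m) t))}.

(* The trace of g from the element K. *)
Definition trace_from (K : I) (g : 'rV[R]_d.+1 -> R) (x : 'rV[R]_d.+1) : R :=
  lim (g y @[y --> within (open_simplex (T K)) (nbhs x)]).

Definition grad_trace (K : I) (V : 'rV[R]_d.+1 -> R) (x : 'rV[R]_d.+1) :
    'cV[R]_d.+1 :=
  \col_i trace_from K (partial i V) x.

(* The boundary of Omega is the union of the boundary faces, which overlap in sets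
   of surface measure zero.  The integrand may depend on the element adjacent to
   the face, so that it can involve traces. *)
Definition bd_integral (G : I -> 'rV[R]_d.+1 -> 'M[R]_d.+1) : 'M[R]_d.+1 :=
  \matrix_(i, j) \sum_K \sum_(m | boundary_face K m)
    simplex_integral (face K m) (fun x => G K x i j).

(* V and Phi are piecewise polynomial, and their gradient is the pointwise one,
   which exists in every open simplex, hence almost everywhere; it represents the
   weak gradient. *)
Definition generalized_hessian (n : 'rV[R]_d.+1 -> 'cV[R]_d.+1)
    (V Phi : 'rV[R]_d.+1 -> R) : 'M[R]_d.+1 :=
  - mx_integral Omega (fun x => outer_prod (grad V x) (grad Phi x)) +
  bd_integral (fun K x =>
    trace_from K Phi x *: outer_prod (grad_trace K V x) (n x)).

Definition pairing (G : 'rV[R]_d.+1 -> 'M[R]_d.+1) (Phi : 'rV[R]_d.+1 -> R) :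
    'M[R]_d.+1 :=
  mx_integral Omega (fun x => Phi x *: G x).

End triangulations.

Section sobolev.
Context (R : realType) (d : nat) (Omega : set 'rV[R]_d).
Implicit Types (f g : 'rV[R]_d -> R) (G : 'rV[R]_d -> 'cV[R]_d).

Fixpoint Ck (k : nat) f : Prop :=
  match k with
  | 0 => continuous f
  | k'.+1 => [/\ continuous f, forall i x, derivable f x (delta_mx ord0 i) &
                 forall i, Ck k' (partial i f)]
  end.

Definition test_function f : Prop :=
  [/\ forall k, Ck k f,
      compact (closure [set x | f x != 0]) &
      closure [set x | f x != 0] `<=` Omega].

Definition L2 f : Prop :=
  measurable_fun Omega f /\
  (leb R d).-integrable Omega (EFin \o (fun x => f x ^+ 2)).

Definition weak_grad f G : Prop :=
  forall i, L2 (fun x => G x i ord0) /\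
    forall phi, test_function phi ->
      \int[leb R d]_(x in Omega) (f x * partial i phi x) =
      - \int[leb R d]_(x in Omega) (G x i ord0 * phi x).

Definition H1 f : Prop := L2 f /\ exists G, weak_grad f G.

(* The closure of the test functions in H1. *)
Definition H1_0 f : Prop :=
  L2 f /\
  exists (G : 'rV[R]_d -> 'cV[R]_d) (phi : nat -> 'rV[R]_d -> R),
    [/\ weak_grad f G, forall k, test_function (phi k),
        \int[leb R d]_(x in Omega) (phi k x - f x) ^+ 2 @[k --> \oo] --> (0 : R) &
        forall i, \int[leb R d]_(x in Omega)
          (partial i (phi k) x - G x i ord0) ^+ 2 @[k --> \oo] --> (0 : R)].

End sobolev.

Section finite_elements.
Import -(notations) mpoly.
Context (R : realType) (d : nat) (Omega : set 'rV[R]_d.+1).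
Context (I : finType) (T : I -> 'M[R]_(d.+2, d.+1)) (p : nat).

(* [msize q <= p.+1] says that q has total degree at most p. *)
Definition polynomial_on (K : set 'rV[R]_d.+1) (f : 'rV[R]_d.+1 -> R) : Prop :=
  exists2 q : mpoly d.+1 R, (msize q <= p.+1)%N &
    forall x, K x -> f x = meval (fun i => x ord0 i) q.

(* Elements of the finite element space are classes of functions modulo equality
   almost everywhere.  They are represented here by those functions that are
   polynomial at every point of each open simplex; their values on the skeleton,
   a null set, are arbitrary.  Every class has such representatives. *)
Definition fe_space (f : 'rV[R]_d.+1 -> R) : Prop :=
  H1 Omega f /\ forall K, polynomial_on (open_simplex (T K)) f.

Definition fe_space0 (f : 'rV[R]_d.+1 -> R) : Prop :=
  fe_space f /\ H1_0 Omega f.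

Definition fe_mx_space (H : 'rV[R]_d.+1 -> 'M[R]_d.+1) : Prop :=
  forall i j, fe_space (fun x => H x i j).

End finite_elements.

(* Main.v *)
Require Import Defs.
From mathcomp Require Import all_boot all_order all_algebra.
From mathcomp Require Import all_classical all_reals all_analysis.
From mathcomp Require Import measurable_realfun.
From mathcomp Require Import lra ring.
From mathcomp Require mpoly.
Set Implicit Arguments.
Unset Strict Implicit.
Unset Printing Implicit Defensive.
Import Order.TTheory GRing.Theory Num.Theory.
Import numFieldNormedType.Exports.
Local Open Scope classical_set_scope.
Local Open Scope ring_scope.

(** Up to null sets, a finite element function is a polynomial of degree at most
p on each simplex, so the finite element space is finite dimensional, and the L2
product of Omega is positive definite on it.  For fixed V each entry of the
generalized Hessian is a linear form in the test function, and the entries of H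
are the Riesz representatives of these forms; they are unique because a function
orthogonal to the whole space is orthogonal to itself.  The work lies in making
sense of this for functions whose values on the skeleton of the mesh are
arbitrary.

Representation is obtained by Gram-Schmidt in [riesz_of_orthogonal], for a
semidefinite form and a linear form that vanishes on its null vectors; the length
of an orthogonal family is bounded by the number of polynomial coefficients
([orthogonal_family_bound], [mesh_coefficientsP]).  Three points have to be
checked.

Integrals over Omega see the simplices only.  The simplices lie in Omega because
a Lipschitz domain is the interior of its closure
([interior_closure_lipschitz]), and what they leave out lies in the zero sets of
the barycentric coordinates, which are hyperplanes ([leb_skeleton]).  On that set
the gradient of V is the limit of arbitrary values and may fail to be
measurable, but removing a null set never changes an integral
([integral_setD_null]), so that [Rintegral_domain] turns every volume integral
into that of a piecewise polynomial.

The boundary term is linear.  The traces are polynomials ([within_lim]), while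
the normal is only given as a function with a geometric property at almost every
point.  At an interior point of a face this property determines it: the inward
directions fill a half-space, so the normal is the normalized opposite of the
gradient of the barycentric coordinate that vanishes on the face
([outward_normal_atE]).  Hence the integrand over a face is almost everywhere a
continuous function ([surface_term_rep]).

Null vectors are killed.  If a piecewise polynomial has zero L2 norm, then it
vanishes at every point of every simplex, since nonempty open sets have positive
measure ([Rintegral_square_eq0]); then so do its gradient and its traces
([generalized_hessian_null]). *)

(** * Integrals and null sets *)

Section null_sets.
Context dd (T : measurableType dd) (R : realType).
Variable mu : {measure set T -> \bar R}.
Local Open Scope ereal_scope.
Import HBNNSimple.

(** A simple function below f is, up to its part on N, whose integral is zero,
a simple function below the restriction of f to the complement of N. *)
Lemma ge0_integral_setC_null (N : set T) (f : T -> \bar R) :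
  measurable N -> mu N = 0 -> (forall x, 0 <= f x) ->
  \int[mu]_x f x = \int[mu]_x (f \_ (~` N)) x.
Proof.
move=> mN N0 f0.
have f'0 x : 0 <= (f \_ (~` N)) x by rewrite /patch; case: ifP.
rewrite !ge0_integralTE//; apply/le_anti/andP; split; apply: ge_ereal_sup.
- move=> _ [h hf <-].
  have mCN := measurableC mN.
  have -> : sintegral mu h = sintegral mu (proj_nnsfun h mCN).
    have -> : sintegral mu h =
        sintegral mu (proj_nnsfun h mN \+ proj_nnsfun h mCN)%R.
      apply: eq_sintegral => x; rewrite -!mrestrict /= /patch in_setC.
      by case: (x \in N); rewrite /= ?addr0 ?add0r.
    rewrite sintegralD.
    have -> : sintegral mu (proj_nnsfun h mN) = 0.
      rewrite -mrestrict -integral_nnsfun//.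
      rewrite -[RHS](@integral_abs_eq0 _ _ _ mu N (EFin \o h))//.
      + by apply: eq_integral => x _ /=; rewrite ger0_norm.
      + by apply/measurable_EFinP; exact: measurable_funTS.
    by rewrite add0e.
  apply: ereal_sup_ubound; exists (proj_nnsfun h mCN) => // x.
  by rewrite -mrestrict /patch; case: ifP => // _; exact: hf.
- move=> _ [h hf <-]; apply: ereal_sup_ubound; exists h => // x.
  by rewrite (le_trans (hf x))// /patch; case: ifP.
Qed.

(** The integral is defined for every function, by lower approximation with
simple functions, so null sets can be removed without any measurability
hypothesis on the integrand. *)
Lemma integral_setD_null (D N : set T) (f : T -> \bar R) :
  measurable N -> mu N = 0 ->
  \int[mu]_(x in D) f x = \int[mu]_(x in D `\` N) f x.
Proof.
move=> mN N0; rewrite integralE [RHS]integralE; congr (_ - _).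
  rewrite integral_mkcond (ge0_integral_setC_null mN N0).
    by rewrite [RHS]integral_mkcond setDE setIC patch_setI.
  by move=> x; rewrite /patch; case: ifP.
rewrite integral_mkcond (ge0_integral_setC_null mN N0).
  by rewrite [RHS]integral_mkcond setDE setIC patch_setI.
by move=> x; rewrite /patch; case: ifP.
Qed.

Lemma eq_Rintegral_ae (D D' N : set T) (f g : T -> R) :
  measurable N -> mu N = 0 -> D `\` N = D' `\` N ->
  (forall x, D x -> ~ N x -> f x = g x) ->
  (\int[mu]_(x in D) f x = \int[mu]_(x in D') g x)%R.
Proof.
move=> mN N0 DD' fg; rewrite /Rintegral; congr fine.
rewrite (integral_setD_null D _ mN N0) [RHS](integral_setD_null D' _ mN N0).
rewrite -DD'; apply: eq_integral => x; rewrite inE => -[Dx Nx].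
by rewrite fg.
Qed.
End null_sets.

(** * Borel sets and Lebesgue measure of R^n *)

Lemma bounded_onP (R : realType) (T : Type) (V : normedModType R) (f : T -> V)
    (A : set T) :
  [bounded f x | x in A] <-> exists M, forall x, A x -> `|f x| <= M.
Proof.
split=> [[M [_ hM]]|[M hM]].
  by exists (M + 1) => x Ax; apply: hM => //; rewrite ltrDl.
exists M; split; first exact: num_real.
by move=> N MN x Ax; apply: (le_trans (hM x Ax)); exact: ltW.
Qed.

Section borel.
Context (R : realType).

Lemma measurable_ball_rV n (c : 'rV[R]_n) (r : R) :
  measurable (ball c r).
Proof.
have [r0|r0] := ltP 0 r; last first.
  rewrite (_ : ball c r = set0)//; apply/seteqP; split=> // x [rp _].
  by move: (lt_le_trans rp r0); rewrite ltxx.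
rewrite (_ : ball c r = \bigcap_(i in [set: 'I_n])
    (@rV_coord R n i @^-1` ball (c ord0 i) r)).
  apply: fin_bigcap_measurable => // i _.
  rewrite -[X in measurable X]setTI; apply: measurable_rV_coord => //.
  exact: measurable_ball.
apply/seteqP; split=> [x [_ h] i _|x h]; first exact: h.
by split=> // j i; rewrite !ord1; exact: h.
Qed.

(** The Borel structure is generated by the coordinates; since rational boxes
form a countable base, it contains the open sets. *)
Lemma open_measurable_rV n (A : set 'rV[R]_n) : open A -> measurable A.
Proof.
move=> oA.
pose F (q : 'rV[rat]_n * rat) : set 'rV[R]_n :=
  let B := ball (map_mx ratr q.1 : 'rV[R]_n) (ratr q.2) in
  if `[< B `<=` A >] then B else set0.
rewrite (_ : A = \bigcup_q F q).
  apply: countable_bigcupT_measurable => // q.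
  by rewrite /F; case: ifP => // _; exact: measurable_ball_rV.
apply/seteqP; split=> [x Ax|x [q _]]; last first.
  by rewrite /F; case: ifP => // /asboolP BA /BA.
have /nbhs_ballP[e /= e0 eA] : nbhs x A by apply: open_nbhs_nbhs; split.
(* A ball of rational center and radius r that contains x lies in the ball of
   radius 2 r around x. *)
have [r re] : exists r : rat, ratr r \in `]0, e / 2[.
  by apply: rat_in_itvoo; rewrite divr_gt0.
have {re} /andP[r0 re] : 0 < (ratr r : R) < e / 2 by rewrite in_itv in re.
have /choice[c hc] : forall i : 'I_n, exists q : rat,
    ratr q \in `]x ord0 i - ratr r, x ord0 i + ratr r[.
  by move=> i; apply: rat_in_itvoo; rewrite ltrBlDr -addrA ltrDl addr_gt0.
have {}hc i : `|ratr (c i) - x ord0 i| < ratr r.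
  by have := hc i; rewrite in_itv/= ltr_distl.
exists (\row_i c i, r) => //; rewrite /F ifT.
  by split=> // i j; rewrite !ord1 !mxE; exact: hc.
apply/asboolP => y [_ hy]; apply: eA; split=> // i j; rewrite !ord1.
have := hy ord0 j; have := hc j; rewrite /ball/= !mxE => h1 h2.
have := ler_distD (ratr (c j)) (x ord0 j) (y ord0 j).
rewrite (distrC (x _ _) (ratr _)) => h3; lra.
Qed.

Lemma closed_measurable_rV n (A : set 'rV[R]_n) : closed A -> measurable A.
Proof.
move=> cA; rewrite -(setCK A); apply: measurableC.
by apply: open_measurable_rV; exact: closed_openC.
Qed.

Lemma continuous_measurable_rV n (f : 'rV[R]_n -> R) (D : set 'rV[R]_n) :
  measurable D -> continuous f -> measurable_fun D f.
Proof.
move=> mD cf; apply: measurable_funTS.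
apply: (measurability _ (RGenOInfty.measurableE R)) => /=.
move=> _ [_ [a ->] <-]; rewrite setTI; apply: open_measurable_rV.
by move/continuousP : cf; apply; exact: interval_open.
Qed.

(** A bounded set lies in a closed ball, which is compact. *)
Lemma continuous_bounded_rV n (f : 'rV[R]_n -> R) (A : set 'rV[R]_n) :
  bounded_set A -> continuous f -> exists M, forall x, A x -> `|f x| <= M.
Proof.
move=> bA cf.
have [M hM] : exists M, forall x, A x -> `|x| <= M.
  by have /bounded_onP := bA.
have cB : compact [set x : 'rV[R]_n | `|x| <= M].
  apply: bounded_closed_compact.
    by apply/bounded_onP; exists M.
  exact: closed_comp (fun x _ => @norm_continuous _ _ x) (@closed_le _ M).
have /compact_bounded/bounded_onP[C hC] :
    compact (f @` [set x : 'rV[R]_n | `|x| <= M]).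
  by apply: continuous_compact => //; exact: continuous_subspaceT.
by exists C => x /hM xM; apply: hC; exists x.
Qed.
End borel.

Section lebesgue.
Context (R : realType).

Lemma leb_ball n (c : 'rV[R]_n) (r : R) : 0 < r ->
  leb R n (ball c r) = ((r *+ 2) ^+ n)%:E.
Proof.
move=> r0; elim: n c => [|n ih] c.
  rewrite expr0 /= diracE mem_set//.
  by split=> // i; case.
rewrite /= /leb_step /pushforward.
rewrite (_ : _ @^-1` _ = ball (c ord0 ord0) r `*`
    ball (\row_(j < n) c ord0 (lift ord0 j)) r).
  rewrite product_measure1E; [|exact: measurable_ball|exact: measurable_ball_rV].
  rewrite [X in (X * _)%E](lebesgue_measure_ball (c ord0 ord0) (ltW r0)).
  by rewrite ih -EFinM exprS.
apply/seteqP; split=> -[a x] /=.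
  move=> [_ h]; split.
    by have := h ord0 ord0; rewrite mxE unlift_none.
  split=> // i j; rewrite !ord1 mxE.
  by have := h ord0 (lift ord0 j); rewrite mxE liftK.
move=> [ha [_ hx]]; split=> // i j; rewrite !ord1 mxE.
case: (unliftP ord0 j) => [k|] -> //.
by have := hx ord0 k; rewrite mxE.
Qed.

Lemma leb_bounded n (A : set 'rV[R]_n) : measurable A -> bounded_set A ->
  (leb R n A < +oo)%E.
Proof.
move=> mA /bounded_onP[M hM].
have M0 : 0 < `|M| + 1 by rewrite ltr_wpDl.
apply: (@le_lt_trans _ _ (leb R n (ball 0 (`|M| + 1)))).
  rewrite le_measure ?inE//; first exact: measurable_ball_rV.
  move=> x /hM /= xM; rewrite mx_norm_ball /ball_/= sub0r normrN.
  by rewrite (le_lt_trans xM)// (le_lt_trans (ler_norm M))// ltrDl.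
by rewrite leb_ball// ltry.
Qed.

Lemma leb_open_gt0 n (A : set 'rV[R]_n) x : open A -> A x ->
  (0 < leb R n A)%E.
Proof.
move=> oA Ax.
have /nbhs_ballP[e /= e0 eA] : nbhs x A by apply: open_nbhs_nbhs; split.
apply: (@lt_le_trans _ _ (leb R n (ball x e))).
  by rewrite leb_ball// lte_fin exprn_gt0// mulrn_wgt0.
by rewrite le_measure ?inE//; [exact: measurable_ball_rV|
  exact: open_measurable_rV].
Qed.

Lemma continuous_integrable_rV n (f : 'rV[R]_n -> R) (A : set 'rV[R]_n) :
  measurable A -> bounded_set A -> continuous f ->
  (leb R n).-integrable A (EFin \o f).
Proof.
move=> mA bA cf; apply: measurable_bounded_integrable => //.
- exact: leb_bounded.
- exact: continuous_measurable_rV.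
- by have [M hM] := continuous_bounded_rV bA cf; apply/bounded_onP; exists M.
Qed.

Definition affine_form n (a : R) (w : 'cV[R]_n) (x : 'rV[R]_n) : R :=
  a + (x *m w) ord0 ord0.

Lemma continuous_affine_form n a (w : 'cV[R]_n) : continuous (affine_form a w).
Proof.
rewrite (_ : affine_form a w = fun x => a + \sum_j x ord0 j * w j ord0); last first.
  by apply/funext => x; rewrite /affine_form mxE.
move=> x; apply: continuousD; first exact: cst_continuous.
apply: continuous_big => [|i _ {}x]; first exact: add_continuous.
by apply: continuousM; [exact: coord_continuous|exact: cst_continuous].
Qed.

(** By induction on the dimension, slicing along the first coordinate.  If some
other coefficient of [w] is nonzero, every slice at a fixed first coordinate is a
hyperplane of the smaller space; otherwise, with the other coordinates fixed,
only one value of the first coordinate is left. *)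
Lemma leb_hyperplane n a (w : 'cV[R]_n) : w != 0 ->
  leb R n [set x | affine_form a w x = 0] = 0%E.
Proof.
have mH m b (v : 'cV[R]_m) : measurable [set x | affine_form b v x = 0].
  apply: closed_measurable_rV.
  rewrite (_ : [set _ | _] = affine_form b v @^-1` [set 0])//.
  have /continuous_closedP := @continuous_affine_form m b v.
  by apply; exact: closed_eq.
elim: n a w => [|n ih] a w w0.
  by case/negP: w0; apply/eqP; rewrite [w]flatmx0.
pose w' : 'cV[R]_n := \col_j w (lift ord0 j) ord0.
set H := [set x | _].
have HE : @rV_cons R n @^-1` H =
    [set p | affine_form (a + p.1 * w ord0 ord0) w' p.2 = 0].
  suff HE (q : measurableTypeR R * 'rV[R]_n) : affine_form a w (rV_cons q) =
      affine_form (a + q.1 * w ord0 ord0) w' q.2.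
    by apply/seteqP; split=> q; rewrite /H /= HE.
  rewrite /affine_form !mxE big_ord_recl !mxE unlift_none addrA.
  by congr (_ + _); apply: eq_bigr => j _; rewrite !mxE liftK.
have mP : measurable (@rV_cons R n @^-1` H).
  by rewrite -[X in measurable X]setTI; apply: measurable_rV_cons => //; exact: mH.
rewrite /= /leb_step /pushforward.
have [w'0|w'0] := eqVneq w' 0; last first.
  apply: integral0_eq => s _ /=.
  rewrite (_ : xsection _ _ = [set x | affine_form (a + s * w ord0 ord0) w' x = 0]).
    exact: ih.
  by rewrite HE; apply/seteqP; split=> x; rewrite /xsection /= inE.
have w00 : w ord0 ord0 != 0.
  apply: contra w0 => /eqP w00; apply/eqP/matrixP => i j; rewrite !ord1 mxE.
  case: (unliftP ord0 i) => [k|] -> //.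
  by have /matrixP/(_ k ord0) := w'0; rewrite !mxE.
(* Here the slices at a fixed first coordinate may be everything, so the
   iterated integral is taken in the other order. *)
rewrite (@product_measure_unique _ _ _ _ _ _ _
  (product_measure2 lebesgue_measure (leb R n)))//; last first.
  by move=> A B mA mB; exact: product_measure2E.
apply: integral0_eq => x _ /=.
rewrite (_ : ysection _ _ = [set (- a / w ord0 ord0)]).
  exact: lebesgue_measure_set1.
rewrite HE; apply/seteqP; split=> s; rewrite /ysection /= inE /= /affine_form w'0
  mulmx0 mxE addr0.
  move=> e; apply: (mulIf w00); rewrite divfK//; apply/eqP.
  by rewrite -addr_eq0 addrC; apply/eqP.
by move=> ->; rewrite divfK// subrr.
Qed.
End lebesgue.

(** * Lipschitz domains have no slits *)

Section lipschitz_closure.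
Context (R : realType).

Lemma continuous_sqrt_rV n (f : 'rV[R]_n -> R) :
  continuous f -> continuous (fun z => Num.sqrt (f z)).
Proof.
move=> cf z; apply: continuous_cvg.
- exact: (nbhs_filter (z : 'rV[R]_n)).
- exact: (@sqrt_continuous R (f z)).
- by apply: cf.
Qed.

Lemma continuousMl_rV n (f : 'rV[R]_n -> R) (a : R) :
  continuous f -> continuous (fun z => a * f z).
Proof.
by move=> cf z; apply: continuousM; [exact: cst_continuous|apply: cf].
Qed.

(** Near a boundary point the set is a strict epigraph, so moving from a point
outside it against the vertical direction leads at once into the open region
strictly below the graph, away from the closure. *)
Lemma interior_closure_lipschitz d (Omega : set 'rV[R]_d.+1) :
  lipschitz_domain Omega -> interior (closure Omega) `<=` Omega.
Proof.
move=> [oO _ _ lO] x xO; apply: contrapT => nxO.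
have [|r [Q [gamma [L [r0 QQ gL OE]]]]] := lO x.
  split; first exact: interior_subset.
  by move=> /interior_subset.
(* The height above the graph: positive in Omega. *)
pose g y := (y *m Q) ord0 ord0 - gamma (col' ord0 (y *m Q)).
have cQ j : continuous (fun z : 'rV[R]_d.+1 => (z *m Q) ord0 j).
  rewrite (_ : (fun _ => _) = affine_form 0 (col j Q)).
    exact: continuous_affine_form.
  by apply/funext => z; rewrite /affine_form add0r !mxE; apply: eq_bigr => k _;
    rewrite !mxE.
have cg : continuous (gamma \o (fun z => col' ord0 (z *m Q))).
  move=> y.
  pose h (z : 'rV[R]_d.+1) := L * enorm (col' ord0 (z *m Q) - col' ord0 (y *m Q)).
  pose f j (z : 'rV[R]_d.+1) :=
    (z *m Q) ord0 (lift ord0 j) - (y *m Q) ord0 (lift ord0 j).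
  have cf j : continuous (f j).
    by move=> z; apply: continuousB; [exact: cQ|exact: cst_continuous].
  have cf2 : continuous (fun z => \sum_j f j z ^+ 2).
    apply: continuous_big => [|j _ z]; first exact: add_continuous.
    exact: continuous_comp (cf j z) (@exprn_continuous _ 2 (f j z)).
  have ch : continuous h.
    rewrite (_ : h = (fun z => L * Num.sqrt (\sum_j f j z ^+ 2))); last first.
      apply/funext => z; rewrite /h /enorm; congr (_ * Num.sqrt _).
      by apply: eq_bigr => j _; rewrite /f !mxE.
    have cs : continuous (fun z => Num.sqrt (\sum_j f j z ^+ 2)).
      exact: continuous_sqrt_rV.
    exact: continuousMl_rV cs.
  have hy : h z @[z --> y] --> (0 : R).
    have -> : (0 : R) = h y.
      rewrite /h subrr /enorm big1 ?sqrtr0 ?mulr0// => i _.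
      by rewrite mxE expr0n.
    exact: ch.
  have FF : Filter (nbhs y) := nbhs_filter y.
  apply/cvgrPdist_lt => e e0.
  have /cvgrPdist_lt/(_ _ e0) := hy.
  apply: filterS => z; rewrite sub0r normrN => he.
  apply: le_lt_trans (le_lt_trans (ler_norm _) he).
  by rewrite distrC; exact: gL.
have {}cg : continuous g by move=> y; apply: continuousB; [exact: cQ|exact: cg].
have gx : g x <= 0.
  by rewrite subr_le0 leNgt; apply/negP => /OE h; apply/nxO/h; exact: ballxx.
(* The vertical direction in the original coordinates. *)
pose v : 'rV[R]_d.+1 := (delta_mx ord0 ord0 : 'rV[R]_d.+1) *m Q^T.
have vQ : v *m Q = delta_mx ord0 ord0.
  have /mulmx1C QQ' := QQ.
  by rewrite -mulmxA QQ' mulmx1.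
have gt (t : R) : g (x - t *: v) = g x - t.
  rewrite /g mulmxBl -scalemxAl vQ.
  have -> : col' ord0 (x *m Q - t *: delta_mx ord0 ord0) = col' ord0 (x *m Q).
    by apply/rowP => j; rewrite !mxE eqxx/= mulr0 subr0.
  by rewrite !mxE !eqxx mulr1 addrAC.
have cx : (x - t *: v) @[t --> (0 : R)] --> x.
  rewrite -[X in _ --> X]subr0 -(scale0r v).
  apply: cvgB; first exact: cvg_cst.
  by apply: cvgZr_tmp; exact: cvg_id.
have nO : \forall t \near 0^'+, ~ closure Omega (x - t *: v).
  have bx : \forall t \near (0 : R)^'+, ball x r (x - t *: v).
    apply: (@cvg_within _ _ _ (fun t => 0 < t)).
    by apply: cx; exact: nbhsx_ballx.
  near=> t => /(_ ([set z | g z < 0] `&` ball x r))[].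
    apply: filterI.
      apply: open_nbhs_nbhs; split.
        by move/continuousP : cg => /(_ _ (@open_lt _ 0)).
      rewrite /= gt; suff : 0 < t by lra.
      by near: t; exact: nbhs_right_gt.
    apply: open_nbhs_nbhs; split; first exact: ball_open.
    by near: t.
  move=> z [zO [/= gz /OE[/(_ zO) h _]]].
  by move: gz; rewrite subr_lt0 => /lt_trans/(_ h); rewrite ltxx.
have yO : \forall t \near 0^'+, closure Omega (x - t *: v).
  by apply: (@cvg_within _ _ _ (fun t => 0 < t)); exact: cx.
have [t [h1 h2]] : exists t : R, ~ closure Omega (x - t *: v) /\
    closure Omega (x - t *: v).
  by apply: (@filter_ex _ (0 : R)^'+); apply: filterI.
by [].
Unshelve. all: by end_near. Qed.
End lipschitz_closure.

(** * Barycentric coordinates *)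

Section barycentric.
Context (R : realType).

(** Bordering the vertices with ones turns affine combinations into linear ones. *)
Definition homogenize m n (a : 'M[R]_(m, n)) : 'M[R]_(m, 1 + n) :=
  row_mx (const_mx 1) a.

Lemma mulmx_homogenize m n (c : 'rV[R]_m) (a : 'M[R]_(m, n)) :
  c *m homogenize a = row_mx (\sum_i c ord0 i)%:M (c *m a).
Proof.
rewrite /homogenize mul_mx_row; congr row_mx; apply/rowP => i.
by rewrite ord1 !mxE eqxx mulr1n; apply: eq_bigr => j _; rewrite mxE mulr1.
Qed.

Variable m : nat.
Implicit Types (a : 'M[R]_(m.+2, m.+1)) (x y : 'rV[R]_m.+1).

(** A kernel vector of [homogenize a] has entries of zero sum, so the entry at
the base vertex can be eliminated and the others annihilate the edges. *)
Lemma homogenize_unitmx a : affinely_free a -> homogenize a \in unitmx.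
Proof.
move=> fa; rewrite -row_free_unit; apply: inj_row_free => c.
rewrite mulmx_homogenize => c0.
have {c0}[c0 ca] : (\sum_i c ord0 i)%:M = 0 :> 'M[R]_1 /\ c *m a = 0.
  by apply: eq_row_mx; rewrite c0 row_mx0.
have {}c0 : \sum_i c ord0 i = 0.
  by have /matrixP/(_ ord0 ord0) := c0; rewrite !mxE eqxx mulr1n.
have cE : (\row_j c ord0 (lift ord0 j)) *m edges a = 0.
  apply/rowP => k; rewrite !mxE.
  transitivity ((c *m a) ord0 k - (\sum_i c ord0 i) * a ord0 k); last first.
    by rewrite c0 mul0r subr0 ca mxE.
  rewrite mxE mulr_suml -sumrB [RHS]big_ord_recl subrr add0r.
  by apply: eq_bigr => j _; rewrite !mxE mulrBr.
have {}cE : \row_j c ord0 (lift ord0 j) = 0 :> 'rV_m.+1.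
  by apply: (row_free_inj fa); rewrite cE mul0mx.
have cl j : c ord0 (lift ord0 j) = 0 by have /rowP/(_ j) := cE; rewrite !mxE.
apply/rowP => i; rewrite mxE; case: (unliftP ord0 i) => [j|] -> //.
by move: c0; rewrite big_ord_recl big1 ?addr0.
Qed.

(** Barycentric coordinates: the coefficients [c] with [\sum_i c_i = 1] and
[x = c *m a] solve a linear system whose matrix is [a] bordered by ones. *)
Definition bary a x : 'rV[R]_m.+2 := row_mx 1%:M x *m invmx (homogenize a).

Definition bary_cst a (i : 'I_m.+2) : R :=
  (invmx (homogenize a) : 'M[R]_(1 + m.+1, m.+2)) (lshift _ ord0) i.

Definition bary_grad a (i : 'I_m.+2) : 'cV[R]_m.+1 :=
  dsubmx (col i (invmx (homogenize a)) : 'M[R]_(1 + m.+1, 1)).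

Lemma baryE a i x :
  bary a x ord0 i = affine_form (bary_cst a i) (bary_grad a i) x.
Proof.
rewrite /bary /affine_form /bary_cst /bary_grad mxE big_split_ord /=.
rewrite big_ord1 row_mxEl !mxE eqxx mulr1n mul1r; congr (_ + _).
by apply: eq_bigr => j _; rewrite row_mxEr !mxE.
Qed.

Lemma bary_comb a (c : 'rV[R]_m.+2) : affinely_free a ->
  \sum_i c ord0 i = 1 -> bary a (c *m a) = c.
Proof.
move=> fa c1; rewrite /bary -c1 -mulmx_homogenize mulmxK//.
exact: homogenize_unitmx.
Qed.

Lemma baryK a x : affinely_free a ->
  \sum_i bary a x ord0 i = 1 /\ bary a x *m a = x.
Proof.
move=> fa; have : bary a x *m homogenize a = row_mx 1%:M x.
  by rewrite /bary mulmxKV//; exact: homogenize_unitmx.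
rewrite mulmx_homogenize => /eq_row_mx[/matrixP/(_ ord0 ord0) h ->]; split=> //.
by move: h; rewrite !mxE eqxx !mulr1n.
Qed.

Lemma open_simplexP a x : affinely_free a ->
  open_simplex a x <-> forall i, 0 < bary a x ord0 i.
Proof.
move=> fa; split=> [[c [c0 c1 ->]] i|h]; first by rewrite bary_comb.
by exists (bary a x); have [? ?] := baryK x fa; split.
Qed.

Lemma continuous_bary a i : continuous (fun x => bary a x ord0 i).
Proof.
rewrite (_ : (fun _ => _) = affine_form (bary_cst a i) (bary_grad a i)).
  exact: continuous_affine_form.
by apply/funext => x; rewrite baryE.
Qed.

Lemma bary_row a i : affinely_free a -> bary a (row i a) = delta_mx ord0 i.
Proof.
move=> fa; rewrite rowE bary_comb// (bigD1 i)//= big1 => [|j ji];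
  by rewrite mxE eqxx/= ?eqxx ?addr0// (negbTE ji).
Qed.

Lemma bary_grad_neq0 a i : affinely_free a -> bary_grad a i != 0.
Proof.
move=> fa; apply/eqP => g0.
have cst x : bary a x ord0 i = bary_cst a i.
  by rewrite baryE /affine_form g0 mulmx0 mxE addr0.
have := cst (row i a); rewrite -(cst (row (lift i ord0) a)) !bary_row// !mxE !eqxx.
by rewrite (negbTE (neq_lift _ _)) => /eqP; rewrite oner_eq0.
Qed.

Lemma open_open_simplex a : affinely_free a -> open (open_simplex a).
Proof.
move=> fa; rewrite openE => x /(open_simplexP _ fa) hx.
have FF : Filter (nbhs x) := nbhs_filter x.
have : \forall y \near x, forall i, 0 < bary a y ord0 i.
  apply: (filter_forall FF) => i; apply: open_nbhs_nbhs; split; last exact: hx.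
  have /continuousP h := @continuous_bary a i.
  exact: (h [set r : R | 0 < r]) (@open_gt R 0).
by apply: filterS => y hy; apply/open_simplexP.
Qed.

Lemma closure_open_simplex a x : affinely_free a ->
  closure (open_simplex a) x -> forall i, 0 <= bary a x ord0 i.
Proof.
move=> fa clx i.
have cl : closed [set y | 0 <= bary a y ord0 i].
  have /continuous_closedP h := @continuous_bary a i.
  exact: (h [set r : R | 0 <= r]) (@closed_ge R 0).
apply: (cl x); move: clx; apply: closureS => y /open_simplexP -/(_ fa)/(_ i).
exact: ltW.
Qed.

Lemma bary_mix a x y (s : R) i :
  bary a (x + s *: (y - x)) ord0 i =
  (1 - s) * bary a x ord0 i + s * bary a y ord0 i.
Proof.
rewrite !baryE /affine_form mulmxDl -scalemxAl mulmxBl !mxE.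
by ring.
Qed.

(** The segment from a point of the closed simplex to a point of the open one lies
in the open simplex, except for its starting point. *)
Lemma open_simplex_mix a x y (s : R) : affinely_free a ->
  (forall i, 0 <= bary a x ord0 i) -> open_simplex a y -> 0 < s <= 1 ->
  open_simplex a (x + s *: (y - x)).
Proof.
move=> fa hx /(open_simplexP _ fa) hy /andP[s0 s1].
apply/open_simplexP => // i; rewrite bary_mix ltr_wpDl//.
  by rewrite mulr_ge0// subr_ge0.
by rewrite mulr_gt0.
Qed.

Lemma open_simplex_nonempty a : affinely_free a -> exists y, open_simplex a y.
Proof.
move=> fa; exists (const_mx (m.+2%:R^-1) *m a).
exists (const_mx (m.+2%:R^-1)); split=> // [i|].
  by rewrite mxE invr_gt0 ltr0n.
rewrite (eq_bigr (fun=> m.+2%:R^-1)); last by move=> i _; rewrite mxE.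
by rewrite sumr_const card_ord -[LHS]mulr_natr mulVf// pnatr_eq0.
Qed.

Lemma mix_cvg (V : normedModType R) (x v : V) :
  (x + s *: v) @[s --> (0 : R)^'+] --> x.
Proof.
have cx : (x + s *: v) @[s --> (0 : R)] --> x.
  rewrite -[X in _ --> X]addr0 -(scale0r v).
  by apply: cvgD; [exact: cvg_cst|apply: cvgZr_tmp; exact: cvg_id].
by move=> B Bx; apply: (@cvg_within _ _ _ (fun s => 0 < s)); exact: cx.
Qed.

Lemma closure_open_simplexW a x : affinely_free a ->
  (forall i, 0 <= bary a x ord0 i) -> closure (open_simplex a) x.
Proof.
move=> fa hx B Bx; have [y hy] := open_simplex_nonempty fa.
have [s [s1 s2]] : exists s : R, B (x + s *: (y - x)) /\
    open_simplex a (x + s *: (y - x)).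
  apply: (@filter_ex _ (0 : R)^'+); apply: filterI.
    exact: mix_cvg Bx.
  near=> s; apply: open_simplex_mix => //; apply/andP; split.
    by near: s; exact: nbhs_right_gt.
  by near: s; exact: nbhs_right_le.
by exists (x + s *: (y - x)).
Unshelve. all: by end_near. Qed.

Lemma face_bary a (k : 'I_m.+2) t : affinely_free a -> @ref_simplex R m t ->
  let x := simplex_param (row' k a) t in
  bary a x ord0 k = 0 /\ forall j, 0 < bary a x ord0 (lift k j).
Proof.
move=> fa [t0 t1] x.
(* The coefficients of x with respect to the vertices of the face. *)
pose b : 'rV[R]_m.+1 := \row_j if unlift ord0 j is Some l then t ord0 l
  else 1 - \sum_l t ord0 l.
have b0 j : 0 < b ord0 j.
  by rewrite mxE; case: (unlift ord0 j) => [l|]; [exact: t0|rewrite subr_gt0].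
have b1 : \sum_j b ord0 j = 1.
  rewrite big_ord_recl mxE unlift_none [X in _ + X](eq_bigr (t ord0)) ?subrK//.
  by move=> l _; rewrite mxE liftK.
have xb : x = b *m row' k a.
  apply/rowP => l; rewrite !mxE big_ord_recl !mxE unlift_none mulrBl mul1r.
  rewrite -addrA; congr (_ + _); rewrite mulr_suml -sumrN -big_split/=.
  by apply: eq_bigr => j _; rewrite !mxE liftK; ring.
(* The same, with a zero inserted at the opposite vertex. *)
pose c : 'rV[R]_m.+2 := \row_i if unlift k i is Some j then b ord0 j else 0.
have c1 : \sum_i c ord0 i = 1.
  rewrite (bigD1_ord k)//= mxE unlift_none add0r -b1.
  by apply: eq_bigr => j _; rewrite [LHS]mxE liftK.
have xc : x = c *m a.
  rewrite xb; apply/rowP => l; rewrite !mxE [RHS](bigD1_ord k)//= mxE.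
  rewrite unlift_none mul0r add0r.
  by apply: eq_bigr => j _; rewrite [c _ _]mxE liftK; congr (_ * _); rewrite mxE.
rewrite xc bary_comb//; split; first by rewrite mxE unlift_none.
by move=> j; rewrite mxE liftK.
Qed.

End barycentric.

(** * The outward normal on a face and the skeleton of the mesh *)

Section normals.
Context (R : realType) (m : nat).
Implicit Types (a : 'M[R]_(m.+2, m.+1)) (x y : 'rV[R]_m.+1).

Definition face_normal a (k : 'I_m.+2) : 'cV[R]_m.+1 :=
  let g := bary_grad a k in
  - (Num.sqrt ((g^T *m g) ord0 ord0))^-1 *: g.

(** Segments from x into the simplex stay in Omega, so [nu] makes no acute angle
with them, and by closure none with the directions from x to the vertices.  As x
is a strictly positive average of the vertices of the face, these directions
average to zero and [nu] is orthogonal to all of them.  The values of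
[y |-> y *m nu] at the vertices are thus those of a multiple of the k-th
barycentric coordinate up to a constant; the multiple is nonpositive, and its
size is fixed by the length of [nu]. *)
Lemma outward_normal_atE (Omega : set 'rV[R]_m.+1) a k x nu :
  affinely_free a -> open_simplex a `<=` Omega ->
  bary a x ord0 k = 0 -> (forall j, 0 < bary a x ord0 (lift k j)) ->
  outward_normal_at Omega x nu -> nu = face_normal a k.
Proof.
move=> fa aO xk xj [nu1 _ nuout].
have x0 i : 0 <= bary a x ord0 i.
  by case: (unliftP k i) => [j|] ->; [exact: ltW|rewrite xk].
(* The level of x along the normal. *)
pose s := (x *m nu) ord0 ord0.
have le_in y : open_simplex a y -> (y *m nu) ord0 ord0 <= s.
  move=> ay; rewrite leNgt; apply/negP => yx.
  have := nuout (y - x); rewrite mulmxBl mxE [X in _ + X]mxE subr_gt0.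
  move=> /(_ yx) nO.
  have [t [t1 t2]] : exists t : R, ~ Omega (x + t *: (y - x)) /\
      open_simplex a (x + t *: (y - x)).
    apply: (@filter_ex _ (0 : R)^'+); apply: filterI; first exact: nO.
    near=> t; apply: open_simplex_mix => //; apply/andP; split.
      by near: t; exact: nbhs_right_gt.
    by near: t; exact: nbhs_right_le.
  exact/t1/aO.
have le_vertex i : (row i a *m nu) ord0 ord0 <= s.
  have ai : closure (open_simplex a) (row i a).
    apply: closure_open_simplexW => // j.
    by rewrite bary_row// mxE eqxx; case: (j == i).
  have cl : closed [set y | affine_form 0 nu y <= s].
    have /continuous_closedP h := @continuous_affine_form R _ 0 nu.
    exact: (h [set r : R | r <= s]) (@closed_le R s).
  have := cl (row i a); rewrite /= /affine_form add0r; apply.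
  by apply: closureS ai => y /le_in; rewrite /= /affine_form add0r.
have [b1 bx] := baryK x fa.
have sum0 : \sum_i bary a x ord0 i * (s - (row i a *m nu) ord0 ord0) = 0.
  under eq_bigr do rewrite mulrBr.
  rewrite sumrB -mulr_suml b1 mul1r {1}/s -{1}bx -mulmxA mxE.
  apply/eqP; rewrite subr_eq0; apply/eqP; apply: eq_bigr => i _.
  by rewrite -row_mul [X in _ = _ * X]mxE.
have face0 j : (row (lift k j) a *m nu) ord0 ord0 = s.
  have /eqP := sum0; rewrite psumr_eq0 => [/allP/(_ (lift k j))|i _]; last first.
    by rewrite mulr_ge0// subr_ge0.
  rewrite mem_index_enum => /(_ isT) /=.
  rewrite mulf_eq0 gt_eqF//= subr_eq0 => /eqP h; exact/esym/h.
(* The level of the opposite vertex relative to the face. *)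
pose al := (row k a *m nu) ord0 ord0 - s.
have al0 : al <= 0 by rewrite subr_le0.
have nuE : nu = al *: bary_grad a k.
  have : homogenize a *m col_mx (- s)%:M nu = al *: delta_mx k ord0.
    apply/colP => i; rewrite [LHS]mxE big_split_ord/= big_ord1.
    rewrite row_mxEl col_mxEu !mxE mul1r mulr1n.
    have -> : \sum_j homogenize a i (rshift 1 j) *
        col_mx (- s)%:M nu (rshift 1 j) ord0 = (row i a *m nu) ord0 ord0.
      rewrite mxE; apply: eq_bigr => j _.
      by rewrite row_mxEr col_mxEd mxE.
    rewrite andbT; have [->|ik] := eqVneq i k.
      by rewrite mulr1 addrC.
    have [j ->|e] := unliftP k i; last by rewrite e eqxx in ik.
    by rewrite face0 addNr mulr0.
  move/(congr1 (mulmx (invmx (homogenize a)))).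
  rewrite mulKmx ?homogenize_unitmx// -scalemxAr -colE.
  move/(congr1 (@dsubmx R 1 m.+1 1)); rewrite col_mxKd => ->.
  by apply/colP => i; rewrite !mxE.
pose q := ((bary_grad a k)^T *m bary_grad a k) ord0 ord0.
have alq : al ^+ 2 * q = 1.
  have nuT : nu^T = al *: (bary_grad a k)^T.
    by rewrite nuE; apply/rowP => i; rewrite !mxE.
  by rewrite -nu1 nuT {1}nuE -scalemxAl -scalemxAr scalerA [RHS]mxE expr2.
have q0 : 0 <= q.
  by rewrite /q mxE sumr_ge0// => i _; rewrite mxE -expr2 sqr_ge0.
rewrite {1}nuE /face_normal -/q; congr (_ *: _).
have qn0 : q != 0 by apply: contra_eqN alq => /eqP ->; rewrite mulr0 eq_sym oner_eq0.
rewrite -sqrtrV//.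
have -> : q^-1 = (- al) ^+ 2.
  by rewrite sqrrN -[LHS]mul1r -alq mulfK.
by rewrite sqrtr_sqr ger0_norm ?opprK// oppr_ge0.
Unshelve. all: by end_near. Qed.

Lemma negligible_fin_bigcup dd (X : measurableType dd)
    (mu : {measure set X -> \bar R}) (J : finType) (F : J -> set X) :
  (forall j, mu.-negligible (F j)) -> mu.-negligible (\bigcup_j F j).
Proof.
move=> hF; apply: (@negligibleS _ _ _ _ (\big[setU/set0]_(j : J) F j)).
  by move=> x [j _ Fx]; rewrite -bigcup_seq; exists j => //=;
    rewrite mem_index_enum.
elim/big_ind: _ => [||j _]; [exact: negligible_set0|exact: negligibleU|].
exact: hF.
Qed.

(** The union of the hyperplanes carrying the faces: larger than the union of the
faces themselves, but null all the same, and described by equations. *)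
Definition skeleton (I : finType) (T : I -> 'M[R]_(m.+2, m.+1)) :=
  \bigcup_K \bigcup_i [set x | bary (T K) x ord0 i = 0].

Lemma bary_hyperplane a i : [set x | bary a x ord0 i = 0] =
  [set x | affine_form (bary_cst a i) (bary_grad a i) x = 0].
Proof. by apply/seteqP; split=> x /=; rewrite baryE. Qed.

Variables (I : finType) (T : I -> 'M[R]_(m.+2, m.+1)).
Hypothesis fT : forall K, affinely_free (T K).

Lemma measurable_skeleton : measurable (skeleton T).
Proof.
apply: fin_bigcup_measurable => // K _; apply: fin_bigcup_measurable => // i _.
apply: closed_measurable_rV.
have /continuous_closedP h := @continuous_bary R m (T K) i.
exact: (h [set 0]) (@closed_eq R 0).
Qed.

Lemma leb_skeleton : leb R m.+1 (skeleton T) = 0%E.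
Proof.
apply/negligibleP; first exact: measurable_skeleton.
apply: negligible_fin_bigcup => K; apply: negligible_fin_bigcup => i.
rewrite bary_hyperplane; exists [set x | affine_form (bary_cst (T K) i)
  (bary_grad (T K) i) x = 0]; split => //.
  rewrite -bary_hyperplane; apply: closed_measurable_rV.
  have /continuous_closedP h := @continuous_bary R m (T K) i.
  exact: (h [set 0]) (@closed_eq R 0).
by apply: leb_hyperplane; exact: bary_grad_neq0.
Qed.

Lemma skeletonP x : (exists K, closure (open_simplex (T K)) x) ->
  ~ skeleton T x -> exists K, open_simplex (T K) x.
Proof.
move=> [K clx] nx; exists K; apply/open_simplexP => // i.
rewrite lt_def closure_open_simplex// andbT; apply/eqP => h.
by apply: nx; exists K => //; exists i.
Qed.
End normals.

(** * The finite element space is a vector space *)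

Section sobolev_linear.
Context (R : realType) (d : nat) (Omega : set 'rV[R]_d).
Hypotheses (mO : measurable Omega) (bO : bounded_set Omega).
Implicit Types (f g : 'rV[R]_d -> R).

Lemma le_integrable_EFin f g :
  measurable_fun Omega f -> (forall x, Omega x -> `|f x| <= g x) ->
  (leb R d).-integrable Omega (EFin \o g) ->
  (leb R d).-integrable Omega (EFin \o f).
Proof.
move=> mf fg ig; apply: le_integrable ig => //; first exact/measurable_EFinP.
move=> x Ox /=; rewrite lee_fin (le_trans (fg x Ox))//.
exact: ler_norm.
Qed.

Lemma L2_comb a f g : L2 Omega f -> L2 Omega g ->
  L2 Omega (fun x => a * f x + g x).
Proof.
move=> [mf f2] [mg g2].
have m : measurable_fun Omega (fun x => a * f x + g x).
  by apply: measurable_funD => //; exact: measurable_funM.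
split=> //.
apply: (@le_integrable_EFin _
  (fun x => (a ^+ 2 *+ 2) * f x ^+ 2 + 2%:R * g x ^+ 2)).
- exact: measurable_funX.
- move=> x _; rewrite ger0_norm ?sqr_ge0//.
  have := sqr_ge0 (a * f x - g x); nra.
- rewrite (_ : EFin \o _ = (fun x => (a ^+ 2 *+ 2)%:E * (f x ^+ 2)%:E)
     \+ (fun x => 2%:E * (g x ^+ 2)%:E))%E//.
  by apply: integrableD => //; exact: integrableZl.
Qed.

Lemma L2_integrableM f g : L2 Omega f -> L2 Omega g ->
  (leb R d).-integrable Omega (EFin \o (fun x => f x * g x)).
Proof.
move=> [mf f2] [mg g2].
apply: (@le_integrable_EFin _ (fun x => f x ^+ 2 + g x ^+ 2)).
- exact: measurable_funM.
- move=> x _; rewrite ler_norml; apply/andP; split.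
    by have := sqr_ge0 (f x + g x); nra.
  by have := sqr_ge0 (f x - g x); nra.
- rewrite (_ : EFin \o _ = (fun x => (f x ^+ 2)%:E) \+ (fun x => (g x ^+ 2)%:E))%E//.
  exact: integrableD.
Qed.

Lemma continuous_L2 f : continuous f -> L2 Omega f.
Proof.
move=> cf; split; first exact: continuous_measurable_rV.
apply: continuous_integrable_rV => // x.
exact: continuous_comp (cf x) (@exprn_continuous _ 2 (f x)).
Qed.

(** Integrals can be split because functions in L2 have integrable products, and
test functions and their derivatives, being continuous, are in L2 of the bounded
set Omega. *)
Lemma weak_grad_comb a f g F G :
  L2 Omega f -> L2 Omega g -> weak_grad Omega f F -> weak_grad Omega g G ->
  weak_grad Omega (fun x => a * f x + g x) (fun x => a *: F x + G x).
Proof.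
move=> f2 g2 fF gG i; have [F2 fi] := fF i; have [G2 gi] := gG i.
split=> [|phi tphi].
  rewrite (_ : (fun _ => _) = fun x => a * F x i ord0 + G x i ord0).
    exact: L2_comb.
  by apply/funext => x; rewrite !mxE.
have [Ckphi _ _] := tphi.
have p2 : L2 Omega phi by apply: continuous_L2; exact: (Ckphi 0).
have dp2 : L2 Omega (partial i phi).
  by apply: continuous_L2; have [_ _ /(_ i)] := Ckphi 1.
have IZ h k : L2 Omega h -> L2 Omega k ->
    (leb R d).-integrable Omega (EFin \o (fun x => a * (h x * k x))).
  move=> h2 k2; rewrite (_ : EFin \o _ = (fun x => a%:E * (h x * k x)%:E)%E)//.
  by apply: integrableZl => //; exact: L2_integrableM.
have lin h k l : L2 Omega h -> L2 Omega k -> L2 Omega l ->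
    \int[leb R d]_(x in Omega) ((a * h x + k x) * l x) =
    a * (\int[leb R d]_(x in Omega) (h x * l x)) +
    \int[leb R d]_(x in Omega) (k x * l x).
  move=> h2 k2 l2; rewrite -RintegralZl//; last exact: L2_integrableM.
  rewrite -RintegralD//; [|exact: IZ|exact: L2_integrableM].
  by apply: eq_Rintegral => x _; rewrite mulrDl mulrA.
rewrite lin// fi// gi//.
rewrite [in RHS](@eq_Rintegral _ _ _ _ _
  (fun x => (a * F x i ord0 + G x i ord0) * phi x)) => [|x _]; last by rewrite !mxE.
by rewrite lin// mulrN opprD.
Qed.

Lemma H1_comb a f g : H1 Omega f -> H1 Omega g ->
  H1 Omega (fun x => a * f x + g x).
Proof.
move=> [f2 [F fF]] [g2 [G gG]]; split; first exact: L2_comb.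
by exists (fun x => a *: F x + G x); exact: weak_grad_comb.
Qed.

Lemma H1_cst0 : H1 Omega (cst 0).
Proof.
have c0 : L2 Omega (cst 0) by apply: continuous_L2 => x; exact: cst_continuous.
split=> //; exists (cst 0) => i; split.
  by rewrite (_ : (fun _ => _) = cst 0)//; apply/funext => x; rewrite mxE.
move=> phi _; rewrite [LHS](_ : _ = 0) ?[X in _ = - X](_ : _ = 0) ?oppr0//.
  rewrite (@eq_Rintegral _ _ _ _ _ (cst 0)) ?Rintegral_cst ?mul0r// => x _.
  by rewrite mxE mul0r.
rewrite (@eq_Rintegral _ _ _ _ _ (cst 0)) ?Rintegral_cst ?mul0r// => x _.
by rewrite mul0r.
Qed.
End sobolev_linear.

Section fe_space_linear.
Import -(notations) mpoly.
Context (R : realType) (d : nat) (Omega : set 'rV[R]_d.+1).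
Hypotheses (mO : measurable Omega) (bO : bounded_set Omega).
Context (I : finType) (T : I -> 'M[R]_(d.+2, d.+1)) (p : nat).

Lemma polynomial_on_comb K a f g :
  polynomial_on p K f -> polynomial_on p K g ->
  polynomial_on p K (fun x : 'rV[R]_d.+1 => a * f x + g x).
Proof.
move=> [q qp fq] [r rp gr]; exists (a *: q + r).
  apply: leq_trans (msizeD_le _ _) _; rewrite geq_max rp andbT.
  exact: leq_trans (msizeZ_le _ _) qp.
by move=> x Kx; rewrite mevalD mevalZ fq// gr.
Qed.

Lemma fe_space_comb a f g : fe_space Omega T p f -> fe_space Omega T p g ->
  fe_space Omega T p (fun x => a * f x + g x).
Proof.
move=> [f1 fp] [g1 gp]; split; first exact: H1_comb.
by move=> K; exact: polynomial_on_comb.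
Qed.

Lemma fe_space_cst0 : fe_space Omega T p (cst 0).
Proof.
split; first exact: H1_cst0.
by move=> K; exists 0; [rewrite msize0|move=> x _; rewrite meval0].
Qed.
End fe_space_linear.

(** * Polynomial functions *)

Section polynomial_functions.
Import -(notations) mpoly.
Context (R : realType) (n : nat).

Definition peval (q : mpoly n R) (x : 'rV[R]_n) : R :=
  meval (fun i => x ord0 i) q.

(** Polynomial functions are the smallest class that contains the constants and
the coordinates and is closed under sums and products. *)
Lemma peval_ind (Q : ('rV[R]_n -> R) -> Prop) :
  (forall c, Q (cst c)) -> (forall i, Q (fun x => x ord0 i)) ->
  (forall f g, Q f -> Q g -> Q (f \+ g)) ->
  (forall f g, Q f -> Q g -> Q (f \* g)) ->
  forall q, Q (peval q).
Proof.
move=> Qc QX QD QM q.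
have Qsum (J : Type) (s : seq J) (F : J -> 'rV[R]_n -> R) :
    (forall j, Q (F j)) -> Q (fun x => \sum_(j <- s) F j x).
  move=> QF; elim: s => [|j s ih].
    by rewrite (_ : (fun _ => _) = cst 0)//; apply/funext => x; rewrite big_nil.
  rewrite (_ : (fun _ => _) = F j \+ (fun x => \sum_(j <- s) F j x)).
    exact: QD.
  by apply/funext => x; rewrite big_cons.
have Qprod (J : Type) (s : seq J) (F : J -> 'rV[R]_n -> R) :
    (forall j, Q (F j)) -> Q (fun x => \prod_(j <- s) F j x).
  move=> QF; elim: s => [|j s ih].
    by rewrite (_ : (fun _ => _) = cst 1)//; apply/funext => x; rewrite big_nil.
  rewrite (_ : (fun _ => _) = F j \* (fun x => \prod_(j <- s) F j x)).
    exact: QM.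
  by apply/funext => x; rewrite big_cons.
rewrite (_ : peval q = fun x => \sum_(m <- msupp q)
  (cst (mcoeff m q) \* (fun x => \prod_i x ord0 i ^+ m i)) x); last first.
  by apply/funext => x; rewrite /peval mevalE.
apply: (Qsum _ _ (fun m => cst (mcoeff m q) \* (fun x => \prod_i x ord0 i ^+ m i))).
move=> m; apply: (QM); first exact: Qc.
apply: (Qprod _ _ (fun i x => x ord0 i ^+ m i)) => i.
elim: (m i) => [|k ih].
  by rewrite (_ : (fun _ => _) = cst 1).
rewrite (_ : (fun _ => _) =
    (fun x : 'rV[R]_n => x ord0 i) \* (fun x => x ord0 i ^+ k)).
  exact: QM.
by apply/funext => x; rewrite exprS.
Qed.

Lemma continuous_peval q : continuous (peval q).
Proof.
apply: (@peval_ind (fun f => continuous f)) => [c|i|f g cf cg|f g cf cg] x.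
- exact: cst_continuous.
- exact: coord_continuous.
- by apply: continuousD; [apply: cf|apply: cg].
- by apply: continuousM; [apply: cf|apply: cg].
Qed.

(** The induction carries along that the function is a polynomial, as the product
rule needs both factors besides their derivatives. *)
Lemma is_derive_peval q v : exists q', forall x, is_derive x v (peval q) (peval q' x).
Proof.
suff [] : (exists r, peval q = peval r) /\
  forall v, exists q', forall x, is_derive x v (peval q) (peval q' x) by [].
apply: (@peval_ind (fun f => (exists r, f = peval r) /\
  forall v, exists q', forall x, is_derive x v f (peval q' x))).
- move=> c; split.
    by exists (mpolyC n c); apply/funext => x; rewrite /peval mevalC.
  move=> w; exists 0 => x; rewrite /peval meval0; exact: is_derive_cst.
- move=> i; split.
    by exists (mpolyX R (mnm1 i)); apply/funext => x; rewrite /peval mevalXU.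
  move=> w; exists (mpolyC n (w ord0 i)) => x; rewrite /peval mevalC.
  have @f : {linear 'rV[R]_n -> R}.
    by exists (fun y : 'rV[R]_n => y ord0 i); do 2![eexists]; do ?[constructor];
      rewrite ?mxE// => ? *; rewrite ?mxE//; move=> ?; rewrite !mxE.
  have cf : continuous f by move=> y; exact: coord_continuous.
  have df : differentiable f x by exact: linear_differentiable.
  apply: DeriveDef; first exact: (diff_derivable (f := f)).
  by rewrite (deriveE (f := f))// diff_lin.
- move=> f g [[qf ->] f'] [[qg ->] g']; split.
    by exists (qf + qg); apply/funext => x; rewrite /peval mevalD.
  move=> w; have [rf hf] := f' w; have [rg hg] := g' w.
  exists (rf + rg) => x; rewrite /peval mevalD; exact: is_deriveD.
- move=> f g [[qf ->] f'] [[qg ->] g']; split.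
    by exists (qf * qg); apply/funext => x; rewrite /peval mevalM.
  move=> w; have [rf hf] := f' w; have [rg hg] := g' w.
  exists (qf * rg + qg * rf) => x; rewrite /peval mevalD !mevalM.
  exact: is_deriveM.
Qed.
End polynomial_functions.

Section piecewise_polynomial.
Import -(notations) mpoly.
Context (R : realType) (n : nat).
Implicit Types (K : set 'rV[R]_n) (f g : 'rV[R]_n -> R).

Definition agrees_with_poly K f := exists q, forall x, K x -> f x = peval q x.

Lemma agrees_with_polyM K f g : agrees_with_poly K f -> agrees_with_poly K g ->
  agrees_with_poly K (f \* g).
Proof.
move=> [q fq] [r gr]; exists (q * r) => x Kx.
by rewrite /= fq// gr// /peval mevalM.
Qed.

Lemma is_derive_agrees K f v : open K -> agrees_with_poly K f ->
  exists q', forall x, K x -> is_derive x v f (peval q' x).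
Proof.
move=> oK [q fq]; have [q' hq'] := is_derive_peval q v.
exists q' => x Kx; apply: near_eq_is_derive (hq' x).
have : nbhs x K by apply: open_nbhs_nbhs; split.
by apply: filterS => y Ky; rewrite fq.
Qed.

Lemma agrees_with_poly_partial K f i : open K -> agrees_with_poly K f ->
  agrees_with_poly K (partial i f).
Proof.
move=> oK /(is_derive_agrees (delta_mx ord0 i) oK)[q' hq'].
by exists q' => x Kx; have := hq' x Kx; rewrite /partial => -[].
Qed.

Lemma partial_comb K f g a i x : open K -> agrees_with_poly K f ->
  agrees_with_poly K g -> K x ->
  partial i (fun y => a * f y + g y) x = a * partial i f x + partial i g x.
Proof.
move=> oK /(is_derive_agrees (delta_mx ord0 i) oK)[f' hf'].
move=> /(is_derive_agrees (delta_mx ord0 i) oK)[g' hg'] Kx.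
have ff := hf' x Kx; have gg := hg' x Kx.
rewrite /partial (_ : (fun y => _) = a *: f + g)//.
by rewrite !derive_val.
Qed.

(** This computes the trace from an element: the polynomial is continuous up to
the closure of K. *)
Lemma within_lim K f q x : closure K x -> (forall y, K y -> f y = peval q y) ->
  lim (f y @[y --> within K (nbhs x)]) = peval q x.
Proof.
move=> clx fq.
have PF : ProperFilter (within K (nbhs x)) := within_nbhs_proper clx.
apply: cvg_lim => //.
have : peval q y @[y --> within K (nbhs x)] --> peval q x.
  apply: cvg_trans; last exact: continuous_peval.
  by apply: cvg_app; exact: cvg_within.
apply: cvg_trans; apply: near_eq_cvg.
by apply: (filterS _ (withinT K (nbhs_filter x))) => y Ky; rewrite fq.
Qed.
End piecewise_polynomial.

(** * Riesz representation in finite dimension *)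

Section finite_dimensional_riesz.
Context (R : realFieldType) (E : lmodType R).
Variables (P : E -> Prop) (B : E -> E -> R) (ell : E -> R).
Hypotheses (P0 : P 0) (Pcomb : forall a f g, P f -> P g -> P (a *: f + g)).
Hypothesis Bcomb : forall a f g h, P f -> P g -> P h ->
  B (a *: f + g) h = a * B f h + B g h.
Hypothesis Bsym : forall f g, B f g = B g f.
Hypothesis Bge0 : forall f, P f -> 0 <= B f f.
Hypothesis ellcomb : forall a f g, P f -> P g ->
  ell (a *: f + g) = a * ell f + ell g.
Hypothesis ell_null : forall f, P f -> B f f = 0 -> ell f = 0.

Lemma sum_closed J (s : seq J) (u : J -> R) (e : J -> E) :
  (forall j, P (e j)) -> P (\sum_(j <- s) u j *: e j).
Proof.
by move=> Pe; elim: s => [|j s ih]; rewrite ?big_nil// big_cons; exact: Pcomb.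
Qed.

Lemma comb_sum (phi : E -> R) :
  (forall a f g, P f -> P g -> phi (a *: f + g) = a * phi f + phi g) ->
  forall J (s : seq J) (u : J -> R) (e : J -> E), (forall j, P (e j)) ->
  phi (\sum_(j <- s) u j *: e j) = \sum_(j <- s) u j * phi (e j).
Proof.
move=> phi_comb J s u e Pe.
(* Additivity at 0 + 0. *)
have phi0 : phi 0 = 0.
  have := phi_comb 1 0 0 P0 P0; rewrite scale1r addr0 mul1r => /eqP.
  by rewrite -subr_eq0 opprD addrA subrr sub0r oppr_eq0 => /eqP.
elim: s => [|j s ih]; first by rewrite !big_nil.
by rewrite !big_cons phi_comb ?ih//; exact: sum_closed.
Qed.

Definition orthogonal_family k (e : 'I_k -> E) :=
  [/\ forall i, P (e i), forall i, 0 < B (e i) (e i) &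
      forall i j, i != j -> B (e i) (e j) = 0].

(** Gram-Schmidt without normalization: an orthogonal family is either extended by
the residual of some vector, or all residuals are null.  In the second case the
linear form depends only on the projection to the span of the family, where it is
represented explicitly.  Since the length of orthogonal families is bounded, the
first case cannot occur forever. *)
Lemma riesz_of_orthogonal N :
  (forall k (e : 'I_k -> E), orthogonal_family e -> (k <= N)%N) ->
  exists h, P h /\ forall f, P f -> B h f = ell f.
Proof.
move=> orthN.
suff ext k (e : 'I_k -> E) : orthogonal_family e ->
    (exists h, P h /\ forall f, P f -> B h f = ell f) \/
    exists e' : 'I_k.+1 -> E, orthogonal_family e'.
  apply: contrapT => noh.
  have : exists e : 'I_N.+1 -> E, orthogonal_family e.
    elim: N.+1 => [|k [e /ext[//|//]]].
    by exists (fun=> 0); split=> -[].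
  by move=> [e /orthN]; rewrite ltnn.
move=> [Pe epos eorth].
(* The coefficients of the orthogonal projection and its residual. *)
pose c f i := B f (e i) / B (e i) (e i).
pose res f := f - \sum_i c f i *: e i.
have resE f : res f = (-1) *: (\sum_i c f i *: e i) + f.
  by rewrite scaleN1r addrC.
have Pres f : P f -> P (res f).
  by move=> Pf; rewrite resE; apply: Pcomb => //; exact: sum_closed.
have Bsum u g : P g -> B (\sum_i u i *: e i) g = \sum_i u i * B (e i) g.
  move=> Pg; apply: (comb_sum (phi := B^~ g)) => // a f1 f2 P1 P2.
  exact: Bcomb.
have resorth f i : P f -> B (res f) (e i) = 0.
  move=> Pf; rewrite resE Bcomb//; last exact: sum_closed.
  rewrite Bsum// (bigD1 i)//= big1 => [|j ji]; last by rewrite eorth ?mulr0.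
  by rewrite addr0 /c divfK ?gt_eqF// mulN1r addNr.
have [[f [Pf fne]]|allnull] :=
  pselect (exists f, P f /\ B (res f) (res f) != 0).
  right; pose e' (i : 'I_k.+1) :=
    if unlift ord_max i is Some j then e j else res f.
  exists e'; split=> [i|i|i j].
  - by rewrite /e'; case: unliftP => [j|] _ //; exact: Pres.
  - rewrite /e'; case: unliftP => [j|] _ //.
    by rewrite lt_def fne Bge0//; exact: Pres.
  - rewrite /e'; case: (unliftP ord_max i) => [i'|] ->;
      case: (unliftP ord_max j) => [j'|] -> ij.
    + by apply: eorth; apply: contra_neq ij => ->.
    + by rewrite Bsym resorth.
    + by rewrite resorth.
    + by rewrite eqxx in ij.
left; exists (\sum_i (ell (e i) / B (e i) (e i)) *: e i); split.
  exact: sum_closed.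
move=> f Pf.
have ell_res : ell (res f) = 0.
  apply: ell_null; first exact: Pres.
  by apply/eqP; apply: contrapT => /negP h; apply: allnull; exists f.
move: ell_res; rewrite resE ellcomb//; last exact: sum_closed.
rewrite (comb_sum (phi := ell))// mulN1r => /eqP; rewrite addrC subr_eq0.
move=> /eqP ->; rewrite Bsum//; apply: eq_bigr => i _.
by rewrite /c (Bsym f) mulrAC [RHS]mulrAC (mulrC (ell _)).
Qed.

(** If the family were longer than the coordinate vectors, the matrix of the
coordinates of its members would have a nonzero left kernel vector.  The
combination with these coefficients is null, and pairing it with a member
returns that member's coefficient times a positive number. *)
Lemma orthogonal_family_bound N (coord : E -> 'rV[R]_N -> Prop) :
  (forall k (e : 'I_k -> E) (c : 'I_k -> 'rV[R]_N) (u : 'rV[R]_k),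
     (forall i, P (e i) /\ coord (e i) (c i)) ->
     \sum_i u ord0 i *: c i = 0 -> 
     let f := \sum_i u ord0 i *: e i in forall g, P g -> B f g = 0) ->
  (forall f, P f -> exists c, coord f c) ->
  forall k (e : 'I_k -> E), orthogonal_family e -> (k <= N)%N.
Proof.
move=> coord_null coordP k e [Pe epos eorth].
have /choice[c hc] i : exists c, coord (e i) c by exact: coordP.
pose C : 'M[R]_(k, N) := \matrix_i c i.
rewrite leqNgt; apply/negP => kN.
have : ~~ row_free C.
  by rewrite /row_free neq_ltn (leq_ltn_trans (rank_leq_col C) kN).
rewrite -kermx_eq0 => /rowV0Pn[u /sub_kermxP uC u0].
move/eqP: u0; apply; apply/rowP => i; rewrite mxE.
have := @coord_null k e c u (fun i => conj (Pe i) (hc i)).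
have -> : \sum_i u ord0 i *: c i = 0.
  transitivity (u *m C); last exact: uC.
  by rewrite mulmx_sum_row; apply: eq_bigr => j _; rewrite rowK.
move=> /(_ erefl) /= /(_ (e i) (Pe i)).
rewrite (comb_sum (phi := B^~ (e i)))// => [|a f g Pf Pg]; last exact: Bcomb.
rewrite (bigD1 i)//= big1 => [|j ji]; last by rewrite eorth ?mulr0.
by rewrite addr0 => /eqP; rewrite mulf_eq0 (gt_eqF (epos i)) orbF => /eqP.
Qed.
End finite_dimensional_riesz.

(** * Integrals over the mesh *)

Section mesh.
Context (R : realType) (d : nat) (Omega : set 'rV[R]_d.+1).
Context (I : finType) (T : I -> 'M[R]_(d.+2, d.+1)).
Hypotheses (lipO : lipschitz_domain Omega) (triT : conforming_triangulation Omega T).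
Implicit Types (f g : 'rV[R]_d.+1 -> R).

Let fT K : affinely_free (T K). Proof. by have [] := triT. Qed.
Let oT K : open (open_simplex (T K)). Proof. exact: open_open_simplex. Qed.
Let mO : measurable Omega.
Proof. by apply: open_measurable_rV; have [] := lipO. Qed.
Let bO : bounded_set Omega. Proof. by have [] := lipO. Qed.

Definition mesh_cells := \bigcup_K open_simplex (T K).

(** An open simplex is an open subset of the closure of Omega. *)
Lemma simplex_sub_domain K : open_simplex (T K) `<=` Omega.
Proof.
apply: subset_trans (interior_closure_lipschitz lipO).
rewrite -open_subsetE//; have [_ _ _ <-] := triT.
by move=> x Kx; exists K => //; exact: subset_closure.
Qed.

Lemma domain_skeleton : Omega `\` skeleton T = mesh_cells `\` skeleton T.
Proof.
apply/seteqP; split=> x [Ox nx]; split=> //; last first.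
  by have [K _ Kx] := Ox; exact: simplex_sub_domain Kx.
have [K Kx] : exists K, open_simplex (T K) x.
  apply: skeletonP => //; have : closure Omega x by exact: subset_closure.
  by have [_ _ _ <-] := triT; move=> [K _ Kx]; exists K.
by exists K.
Qed.

Lemma measurable_mesh_cells : measurable mesh_cells.
Proof. by apply: open_measurable_rV; exact: bigcup_open. Qed.

(** Outside of the simplices [f] is arbitrary: there it may be the derivative of a
function with arbitrary values. *)
Lemma Rintegral_domain f g : (forall x, mesh_cells x -> f x = g x) ->
  \int[leb R d.+1]_(x in Omega) f x = \int[leb R d.+1]_(x in mesh_cells) g x.
Proof.
move=> fg; apply: (eq_Rintegral_ae (measurable_skeleton T) (leb_skeleton fT)).
  exact: domain_skeleton.
move=> x Ox nx; apply: fg.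
by have [] : (mesh_cells `\` skeleton T) x by rewrite -domain_skeleton.
Qed.

Definition piecewise_poly f := forall K, agrees_with_poly (open_simplex (T K)) f.

Lemma piecewise_polyM f g : piecewise_poly f -> piecewise_poly g ->
  piecewise_poly (f \* g).
Proof. by move=> pf pg K; exact: agrees_with_polyM. Qed.

Lemma piecewise_poly_partial i f : piecewise_poly f ->
  piecewise_poly (partial i f).
Proof. by move=> pf K; exact: agrees_with_poly_partial. Qed.

Lemma piecewise_poly_integrable f : piecewise_poly f ->
  (leb R d.+1).-integrable mesh_cells (EFin \o f).
Proof.
move=> /choice[q fq].
have cO : mesh_cells `<=` Omega.
  by move=> x [K _ Kx]; exact: simplex_sub_domain Kx.
have mU := measurable_mesh_cells.
apply: measurable_bounded_integrable => //.
- apply: leb_bounded => //.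
  have /bounded_onP[M hM] := bO; apply/bounded_onP; exists M => x /cO.
  exact: hM.
- move=> _ Y mY.
  rewrite (_ : _ `&` _ = \bigcup_K (open_simplex (T K) `&` peval (q K) @^-1` Y)).
    apply: fin_bigcup_measurable => // K _.
    have mK := open_measurable_rV (@oT K).
    by apply: continuous_measurable_rV => //; exact: continuous_peval.
  apply/seteqP; split=> [x [[K _ Kx] Yx]|x [K _ [Kx Yx]]].
    by exists K => //; split=> //; rewrite /preimage /= -(fq _ _ Kx).
  by split; [exists K|rewrite /preimage /= (fq _ _ Kx)].
- have /choice[M hM] K : exists M, forall x, Omega x -> `|peval (q K) x| <= M.
    by apply: continuous_bounded_rV => //; exact: continuous_peval.
  apply/bounded_onP; exists (\sum_K `|M K|) => x Ux; have [K _ Kx] := Ux.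
  rewrite (fq _ _ Kx); apply: le_trans (hM K _ (cO _ Ux)) _.
  rewrite (bigD1 K)//= (le_trans (ler_norm _))// lerDl.
  by rewrite sumr_ge0.
Qed.

Lemma Rintegral_mesh_comb a f g : piecewise_poly f -> piecewise_poly g ->
  \int[leb R d.+1]_(x in mesh_cells) (a * f x + g x) =
  a * (\int[leb R d.+1]_(x in mesh_cells) f x) +
  \int[leb R d.+1]_(x in mesh_cells) g x.
Proof.
move=> /piecewise_poly_integrable intf /piecewise_poly_integrable intg.
have mU := measurable_mesh_cells.
rewrite -RintegralZl// -RintegralD//.
rewrite (_ : EFin \o _ = fun x => a%:E * (EFin \o f) x)%E//.
exact: integrableZl.
Qed.

(** The square vanishes almost everywhere on the simplices; if the polynomial were
nonzero at one point of a simplex, it would be so on a nonempty open subset,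
which has positive measure. *)
Lemma Rintegral_square_eq0 f : piecewise_poly f ->
  \int[leb R d.+1]_(x in Omega) (f x * f x) = 0 ->
  forall x, mesh_cells x -> f x = 0.
Proof.
move=> pf; rewrite (@Rintegral_domain _ (f \* f))// => int0 x [K _ Kx].
have mU := measurable_mesh_cells.
have intff := piecewise_poly_integrable (piecewise_polyM pf pf).
have {}int0 : (\int[leb R d.+1]_(x in mesh_cells) `|(f x * f x)%:E| = 0)%E.
  rewrite -[RHS]/((0 : R)%:E) -int0 /Rintegral fineK; last exact: integrable_fin_num.
  by apply: eq_integral => y _ /=; rewrite ger0_norm// -expr2 sqr_ge0.
have {int0} : ae_eq (leb R d.+1) mesh_cells (fun x => (f x * f x)%:E) (cst 0%E).
  by apply/ae_eq_integral_abs => //; have /integrableP[] := intff.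
move=> [Z [mZ Z0 UZ]]; apply: contrapT => fx0.
have [q fq] := pf K.
(* A nonempty open set that would have to be null. *)
pose A := open_simplex (T K) `&` peval q @^-1` [set y | y != 0].
have oA : open A.
  apply: openI => //; have /continuousP h := @continuous_peval _ _ q.
  exact: (h [set y : R | y != 0]) (@open_neq R 0).
have : (0 < leb R d.+1 A)%E.
  by apply: (leb_open_gt0 (x := x)) => //; split=> //=; rewrite -fq//; apply/eqP.
have : (leb R d.+1 A <= leb R d.+1 Z)%E.
  rewrite le_measure ?inE//; first exact: open_measurable_rV.
  move=> y [Ky /= qy]; apply: UZ => /= h.
  have /h : mesh_cells y by exists K.
  rewrite fq// => -[/eqP]; rewrite mulf_eq0 orbb.
  by rewrite (negbTE qy).
by rewrite Z0 => /le_lt_trans h /h; rewrite ltxx.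
Qed.
End mesh.

(** * Boundary terms *)

Section surface.
Import -(notations) mpoly.
Context (R : realType) (d : nat) (Omega : set 'rV[R]_d.+1).
Context (I : finType) (T : I -> 'M[R]_(d.+2, d.+1)).
Context (n : 'rV[R]_d.+1 -> 'cV[R]_d.+1).
Hypotheses (lipO : lipschitz_domain Omega) (triT : conforming_triangulation Omega T).
Hypothesis nO : outward_unit_normal Omega T n.
Implicit Types (f g V : 'rV[R]_d.+1 -> R).

Let fT K : affinely_free (T K). Proof. by have [] := triT. Qed.

Lemma measurable_ref_simplex m : measurable (@ref_simplex R m).
Proof.
rewrite (_ : @ref_simplex R m = (\bigcap_(i in [set: 'I_m])
    (@rV_coord R m i @^-1` `]0, +oo[)) `&`
    (affine_form 0 (const_mx 1 : 'cV[R]_m) @^-1` [set y | y < 1])).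
  apply: measurableI.
    apply: fin_bigcap_measurable => // i _.
    rewrite -[X in measurable X]setTI; apply: measurable_rV_coord => //.
  apply: open_measurable_rV.
  have /continuousP h := @continuous_affine_form R m 0 (const_mx 1).
  exact: (h [set y : R | y < 1]) (@open_lt R 1).
have aE t : affine_form 0 (const_mx 1 : 'cV[R]_m) t = \sum_i t ord0 i.
  by rewrite /affine_form add0r mxE; apply: eq_bigr => i _; rewrite mxE mulr1.
apply/seteqP; split=> t /=; rewrite aE.
  by move=> [t0 t1]; split=> // i _ /=; rewrite in_itv/= andbT; exact: t0.
by move=> [t0 t1]; split=> // i; have := t0 i Logic.I; rewrite /= in_itv/= andbT.
Qed.

Lemma bounded_ref_simplex m : bounded_set (@ref_simplex R m).
Proof.
apply/bounded_onP; exists 1 => t [t0 t1].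
have : ball (0 : 'rV[R]_m) 1 t.
  split=> // i j; rewrite !ord1 mxE /ball/= sub0r normrN gtr0_norm//.
  apply: le_lt_trans t1; rewrite (bigD1 j)//= lerDl.
  by apply: sumr_ge0 => k _; exact: ltW.
by rewrite mx_norm_ball /ball_/= sub0r normrN => /ltW.
Qed.

Lemma continuous_peval_param m k (a : 'M[R]_(m.+1, k)) q :
  continuous (fun t => peval q (simplex_param a t)).
Proof.
pose Q (f : 'rV[R]_k -> R) := continuous (fun t : 'rV[R]_m => f (simplex_param a t)).
rewrite -/(Q (peval q)); apply: peval_ind.
- by move=> c t; exact: cst_continuous.
- move=> i; rewrite /Q (_ : (fun _ => _) =
    affine_form (a ord0 i) (col i (edges a))); first exact: continuous_affine_form.
  apply/funext => t; rewrite /simplex_param /affine_form !mxE; congr (_ + _).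
  by apply: eq_bigr => l _; rewrite !mxE.
- by move=> f g cf cg t; apply: continuousD; [apply: cf|apply: cg].
- move=> f g cf cg t.
  apply: (@continuousM R _ (fun t => f (simplex_param a t))
    (fun t => g (simplex_param a t))); [exact: cf|exact: cg].
Qed.

Lemma face_point K k t : ref_simplex t ->
  let x := simplex_param (face T K k) t in
  [/\ bary (T K) x ord0 k = 0, forall j, 0 < bary (T K) x ord0 (lift k j) &
      closure (open_simplex (T K)) x].
Proof.
move=> reft x; have [xk xj] := face_bary k (fT K) reft; split=> //.
apply: closure_open_simplexW => // i.
by case: (unliftP k i) => [j|] ->; [exact/ltW/xj|rewrite xk].
Qed.

(** Outside of a null set of parameters the normal is the constant normal of the
face.  The exceptional set and the weight [w] do not depend on [f], which is what
makes the boundary integral linear in [f]. *)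
Lemma surface_term_rep V K k i j : piecewise_poly T V ->
  boundary_face Omega T K k ->
  exists (Z : set 'rV[R]_d) (w : 'rV[R]_d -> R),
    [/\ measurable Z, leb R d Z = 0%E, continuous w &
    forall f q, (forall x, open_simplex (T K) x -> f x = peval q x) ->
    forall t, ref_simplex t -> ~ Z t -> let x := simplex_param (face T K k) t in
      (trace_from T K f x *: outer_prod (grad_trace T K V x) (n x)) i j =
      peval q x * w t].
Proof.
move=> pV bf; have [Z [mZ Z0 hZ]] := nO bf.
have [q' hq'] := piecewise_poly_partial triT i pV K.
exists Z, (fun t => peval q' (simplex_param (face T K k) t) *
  face_normal (T K) k j ord0); split=> //.
  move=> t; apply: (@continuousM R _ (fun t => peval q' (simplex_param _ t))
    (cst _)); [exact: continuous_peval_param|exact: cst_continuous].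
move=> f q fq t reft nZt x.
have [xk xj clx] := face_point K k reft.
have nx : n x = face_normal (T K) k.
  apply: (outward_normal_atE (fT K) (simplex_sub_domain lipO triT (K := K)) xk xj).
  by apply: contrapT => h; apply: nZt; apply: hZ => /= /(_ reft).
rewrite mxE /outer_prod mxE big_ord1 /grad_trace.
rewrite [X in _ * (X * _)]mxE [X in _ * (_ * X)]mxE nx /trace_from.
by rewrite (within_lim clx fq) (within_lim clx hq').
Qed.

Definition surface_term V K k i j f : R := simplex_integral (face T K k)
  (fun x => (trace_from T K f x *: outer_prod (grad_trace T K V x) (n x)) i j).

Lemma surface_term_comb V K k i j a f g : piecewise_poly T V ->
  boundary_face Omega T K k -> piecewise_poly T f -> piecewise_poly T g ->
  surface_term V K k i j (fun x => a * f x + g x) =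
  a * surface_term V K k i j f + surface_term V K k i j g.
Proof.
move=> pV bf /(_ K)[q fq] /(_ K)[r gr].
have [Z [w [mZ Z0 cw rep]]] := surface_term_rep i j pV bf.
have mref := @measurable_ref_simplex d.
have intE h s : (forall x, open_simplex (T K) x -> h x = peval s x) ->
    surface_term V K k i j h =
    Num.sqrt (\det (edges (face T K k) *m (edges (face T K k))^T)) *
    \int[leb R d]_(t in @ref_simplex R d)
      (peval s (simplex_param (face T K k) t) * w t).
  move=> hs; congr (_ * _).
  by apply: (eq_Rintegral_ae mZ Z0) => // t reft nZ; exact: rep.
have intw s : (leb R d).-integrable (@ref_simplex R d)
    (EFin \o (fun t => peval s (simplex_param (face T K k) t) * w t)).
  apply: continuous_integrable_rV => //; first exact: bounded_ref_simplex.
  move=> t; apply: (@continuousM R _ (fun t => peval s (simplex_param _ t)));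
    [exact: continuous_peval_param|exact: cw].
rewrite (intE _ _ fq) (intE _ _ gr).
rewrite (intE _ (mpolyC d.+1 a * q + r)); last first.
  by move=> x Kx; rewrite /peval mevalD mevalM mevalC fq// gr.
rewrite mulrCA -mulrDr; congr (_ * _).
rewrite -RintegralZl// -RintegralD//; last first.
  rewrite (_ : EFin \o _ = fun t => (a%:E *
    (peval q (simplex_param (face T K k) t) * w t)%:E)%E)//.
  by apply: integrableZl => //; exact: intw.
apply: eq_Rintegral => t _.
by rewrite /peval mevalD mevalM mevalC mulrDl mulrA.
Qed.

Lemma surface_term_null V K k i j f : piecewise_poly T V ->
  boundary_face Omega T K k -> (forall x, open_simplex (T K) x -> f x = 0) ->
  surface_term V K k i j f = 0.
Proof.
move=> pV bf f0.
have [Z [w [mZ Z0 cw rep]]] := surface_term_rep i j pV bf.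
rewrite /surface_term /simplex_integral.
rewrite (@eq_Rintegral_ae _ _ _ _ _ (@ref_simplex R d) _ _ (cst 0) mZ Z0)//.
  by rewrite Rintegral_cst ?mul0r ?mulr0//; exact: measurable_ref_simplex.
move=> t reft nZ; rewrite (rep f 0)//; last first.
  by move=> x Kx; rewrite f0// /peval meval0.
by rewrite /peval meval0 mul0r.
Qed.
End surface.

(** * The discrete Hessian *)

Section hessian.
Import -(notations) mpoly.
Context (R : realType) (d : nat) (Omega : set 'rV[R]_d.+1).
Context (n : 'rV[R]_d.+1 -> 'cV[R]_d.+1).
Context (I : finType) (T : I -> 'M[R]_(d.+2, d.+1)) (p : nat).
Hypotheses (lipO : lipschitz_domain Omega) (triT : conforming_triangulation Omega T).
Hypothesis nO : outward_unit_normal Omega T n.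
Implicit Types (f g V : 'rV[R]_d.+1 -> R).

Let fT K : affinely_free (T K). Proof. by have [] := triT. Qed.
Let oT K : open (open_simplex (T K)). Proof. exact: open_open_simplex. Qed.
Let mO : measurable Omega.
Proof. by apply: open_measurable_rV; have [] := lipO. Qed.
Let bO : bounded_set Omega. Proof. by have [] := lipO. Qed.

Lemma fe_space_piecewise_poly f : fe_space Omega T p f -> piecewise_poly T f.
Proof. by move=> [_ pf] K; have [q _ fq] := pf K; exists q. Qed.

Lemma generalized_hessianE V f i j : generalized_hessian Omega T n V f i j =
  - (\int[leb R d.+1]_(x in Omega) (partial i V x * partial j f x)) +
  \sum_K \sum_(k | boundary_face Omega T K k) surface_term T n V K k i j f.
Proof.
rewrite /generalized_hessian [LHS]mxE [X in X + _]mxE [X in _ + X]mxE.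
congr (- _ + _); rewrite mxE; apply: eq_Rintegral => x _.
by rewrite /outer_prod mxE big_ord1 !mxE.
Qed.

Lemma generalized_hessian_comb V i j a f g : piecewise_poly T V ->
  piecewise_poly T f -> piecewise_poly T g ->
  generalized_hessian Omega T n V (fun x => a * f x + g x) i j =
  a * generalized_hessian Omega T n V f i j + generalized_hessian Omega T n V g i j.
Proof.
move=> pV pf pg; rewrite !generalized_hessianE.
have pd h := piecewise_poly_partial triT j (f := h).
have pVi := piecewise_poly_partial triT i pV.
rewrite (Rintegral_domain lipO triT (g := fun x =>
    a * (partial i V \* partial j f) x + (partial i V \* partial j g) x)); last first.
  move=> x [K _ Kx]; rewrite (partial_comb _ _ (@oT K))// /=.
  by rewrite mulrDr mulrCA.
rewrite (Rintegral_mesh_comb lipO triT); try exact: piecewise_polyM (pd _ _).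
rewrite (Rintegral_domain lipO triT (f := fun x => partial i V x * partial j f x)
  (g := partial i V \* partial j f))//.
rewrite (Rintegral_domain lipO triT (f := fun x => partial i V x * partial j g x)
  (g := partial i V \* partial j g))//.
rewrite [X in _ + X = _](_ : _ = a *
  (\sum_K \sum_(k | boundary_face Omega T K k) surface_term T n V K k i j f) +
  \sum_K \sum_(k | boundary_face Omega T K k) surface_term T n V K k i j g).
  by ring.
rewrite mulr_sumr -big_split/=; apply: eq_bigr => K _.
rewrite mulr_sumr -big_split/=; apply: eq_bigr => k bf.
exact: (surface_term_comb lipO triT nO).
Qed.

(** The gradient is zero on the open simplices and the traces are limits from
them. *)
Lemma generalized_hessian_null V i j f : piecewise_poly T V ->
  (forall x, mesh_cells T x -> f x = 0) ->
  generalized_hessian Omega T n V f i j = 0.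
Proof.
move=> pV f0; rewrite generalized_hessianE.
rewrite (Rintegral_domain lipO triT (g := cst 0)); last first.
  move=> x [K _ Kx]; rewrite [partial j f x](_ : _ = 0) ?mulr0//.
  rewrite /partial (near_eq_derive _ (g := cst 0)); first exact: derive_cst.
  have : nbhs x (open_simplex (T K)) by apply: open_nbhs_nbhs; split.
  by apply: filterS => y Ky; rewrite f0//; exists K.
rewrite Rintegral_cst ?mul0r ?oppr0 ?add0r; last exact: measurable_mesh_cells triT.
apply: big1 => K _; apply: big1 => k bf.
by apply: (surface_term_null lipO triT nO) => // x Kx; apply: f0; exists K.
Qed.

Definition L2_product f g : R := \int[leb R d.+1]_(x in Omega) (f x * g x).

Lemma L2_product_comb a f g h : piecewise_poly T f -> piecewise_poly T g ->
  piecewise_poly T h ->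
  L2_product (fun x => a * f x + g x) h = a * L2_product f h + L2_product g h.
Proof.
move=> pf pg ph; rewrite /L2_product.
rewrite (Rintegral_domain lipO triT (g := fun x => a * (f \* h) x + (g \* h) x)).
  rewrite (Rintegral_mesh_comb lipO triT); try exact: piecewise_polyM.
  by congr (_ * _ + _); apply/esym; exact: Rintegral_domain.
by move=> x _; rewrite mulrDl mulrA.
Qed.

(** Together with [generalized_hessian_null]: both sides of the defining equation
see a function only through its values on the open simplices. *)
Lemma L2_product_null f g : (forall x, mesh_cells T x -> f x = 0) ->
  L2_product f g = 0.
Proof.
move=> f0; rewrite /L2_product (Rintegral_domain lipO triT (g := cst 0)).
  by rewrite Rintegral_cst ?mul0r//; exact: measurable_mesh_cells triT.
by move=> x Ux; rewrite f0// mul0r.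
Qed.

(** A relation rather than a function, so that it passes to linear combinations
without any choice of coefficients. *)
Definition mesh_coefficients (f : 'rV[R]_d.+1 -> R)
    (c : 'rV[R]_#|{: I * bmultinom d.+1 p.+1}|) :=
  forall K x, open_simplex (T K) x ->
    f x = \sum_(m : bmultinom d.+1 p.+1)
      c ord0 (enum_rank (K, m)) * peval (mpolyX R m) x.

Lemma mesh_coefficientsP f : fe_space Omega T p f ->
  exists c, mesh_coefficients f c.
Proof.
move=> [_ /(_ _)/cid2-/all_sig2[q qp fq]].
exists (\row_(l < #|{: I * bmultinom d.+1 p.+1}|)
  mcoeff (enum_val l).2 (q (enum_val l).1)) => K x Kx.
rewrite (fq _ _ Kx) [in LHS](mpolywE (qp K)) raddf_sum/=; apply: eq_bigr => m _.
by rewrite mxE enum_rankK mevalZ.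
Qed.

Lemma riesz_fe_space V i j : piecewise_poly T V ->
  exists h, fe_space Omega T p h /\ forall f, fe_space Omega T p f ->
    L2_product h f = generalized_hessian Omega T n V f i j.
Proof.
move=> pV; pose E : lmodType R := ('rV[R]_d.+1 -> R^o).
have P0 : fe_space Omega T p (0 : E) by exact: fe_space_cst0.
have Pcomb a (f g : E) : fe_space Omega T p f -> fe_space Omega T p g ->
    fe_space Omega T p (a *: f + g) by exact: fe_space_comb.
have pp := fe_space_piecewise_poly.
have Bcomb a (f g h : E) : fe_space Omega T p f -> fe_space Omega T p g ->
    fe_space Omega T p h ->
    L2_product (a *: f + g) h = a * L2_product f h + L2_product g h.
  by move=> /pp ? /pp ? /pp ?; exact: L2_product_comb.
have Bsym (f g : E) : L2_product f g = L2_product g f.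
  by apply: eq_Rintegral => x _; rewrite mulrC.
apply: (@riesz_of_orthogonal R E (fe_space Omega T p) L2_product) => //.
- by move=> f _; apply: Rintegral_ge0 => x _; rewrite -expr2 sqr_ge0.
- by move=> a f g /pp ? /pp ?; exact: generalized_hessian_comb.
- move=> f /pp pf f0; apply: generalized_hessian_null => // x.
  exact: (Rintegral_square_eq0 lipO triT).
- apply: (orthogonal_family_bound P0 Pcomb Bcomb (coord := mesh_coefficients)).
    move=> k e c u ec uc f g _; apply: L2_product_null => x [K _ Kx].
    rewrite /f fct_sumE.
    transitivity (\sum_(m : bmultinom d.+1 p.+1)
        (\sum_l u ord0 l *: c l) ord0 (enum_rank (K, m)) * peval (mpolyX R m) x).
      under [RHS]eq_bigr do rewrite summxE mulr_suml.
      rewrite exchange_big/=; apply: eq_bigr => l _.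
      transitivity (u ord0 l * e l x) => //.
      rewrite ((ec l).2 _ _ Kx) mulr_sumr; apply: eq_bigr => m _.
      by rewrite mxE mulrA.
    by rewrite uc big1// => m _; rewrite mxE mul0r.
  exact: mesh_coefficientsP.
Qed.
End hessian.

Theorem theorem2p4 (R : realType) (d : nat) (Omega : set 'rV[R]_d.+1)
    (n : 'rV[R]_d.+1 -> 'cV[R]_d.+1)
    (I : finType) (T : I -> 'M[R]_(d.+2, d.+1)) (p : nat) :
  lipschitz_domain Omega ->
  conforming_triangulation Omega T ->
  outward_unit_normal Omega T n ->
  (1 <= p)%N ->
  forall V : 'rV[R]_d.+1 -> R, fe_space0 Omega T p V ->
  exists H : 'rV[R]_d.+1 -> 'M[R]_d.+1,
    [/\ fe_mx_space Omega T p H,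
        forall Phi, fe_space Omega T p Phi ->
          pairing Omega H Phi = generalized_hessian Omega T n V Phi &
        forall H' : 'rV[R]_d.+1 -> 'M[R]_d.+1,
          fe_mx_space Omega T p H' ->
          (forall Phi, fe_space Omega T p Phi ->
            pairing Omega H' Phi = generalized_hessian Omega T n V Phi) ->
          {ae leb R d.+1, forall x, Omega x -> H' x = H x}].
Proof.
move=> lipO triT nO _ V [/fe_space_piecewise_poly pV _].
have fT K : affinely_free (T K) by have [] := triT.
have mO : measurable Omega by apply: open_measurable_rV; have [] := lipO.
have bO : bounded_set Omega by have [] := lipO.
have /choice[h hP] (ij : 'I_d.+1 * 'I_d.+1) :=
  riesz_fe_space p lipO triT nO ij.1 ij.2 pV.
have pairE (G : 'rV[R]_d.+1 -> 'M[R]_d.+1) Phi i j :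
    pairing Omega G Phi i j = L2_product Omega (fun x => G x i j) Phi.
  by rewrite mxE; apply: eq_Rintegral => x _; rewrite mxE mulrC.
pose H x : 'M[R]_d.+1 := \matrix_(i, j) h (i, j) x.
have HE i j : (fun x => H x i j) = h (i, j) by apply/funext => x; rewrite mxE.
exists H; split=> [i j|Phi fPhi|H' fH' HH'].
- by rewrite HE; have [] := hP (i, j).
- by apply/matrixP => i j; rewrite pairE HE; have [_ ->] := hP (i, j).
have eqH x i j : mesh_cells T x -> H' x i j = H x i j.
  have [hij hijP] := hP (i, j).
  pose g y := (-1) * h (i, j) y + H' y i j.
  have fg : fe_space Omega T p g by apply: fe_space_comb => //; exact: fH'.
  have gg : L2_product Omega g g = 0.
    rewrite {1}/g (L2_product_comb lipO triT);
      [|exact: fe_space_piecewise_poly hij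
       |exact: fe_space_piecewise_poly (fH' i j)
       |exact: fe_space_piecewise_poly fg].
    by rewrite hijP// -HH'// pairE mulN1r addNr.
  move=> Ux; have := Rintegral_square_eq0 lipO triT (fe_space_piecewise_poly fg) gg Ux.
  by rewrite /g mulN1r addrC => /eqP; rewrite subr_eq0 mxE => /eqP.
exists (skeleton T); split.
- exact: measurable_skeleton.
- exact: leb_skeleton.
move=> x /= nHx; apply: contrapT => nx; apply: nHx => Ox.
have [Ux _] : (mesh_cells T `\` skeleton T) x.
  by rewrite -(domain_skeleton lipO triT); split.
by apply/matrixP => i j; exact: eqH.
Qed.
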